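(* Let $(\Omega,d,\mu)$ be a doubling metric measure space with upper dimension $Q$ that satisfies the non-collapsing condition $\inf_{x\in\Omega}\mu(B(x,1))=b>0$. Let $X$ be an r.i. space on $\Omega$, $0<\alpha\le1$, $0<s<1$, $0<q\le\infty$, and define $m:[0,1]\to[0,\infty]$ by $$m(t)=m_{X,s,\alpha,q}(t)=\begin{cases}\displaystyle\int_t^1\left(\frac{z^{s/Q}}{\phi_{X^{(\alpha)}}(z)}\right)^{\frac{\alpha q}{q-\alpha}}\frac{dz}z&\text{if }\alpha<q<\infty,\\[2mm]\displaystyle\int_t^1\left(\frac{z^{s/Q}}{\phi_{X^{(\alpha)}}(z)}\right)^{\alpha}\frac{dz}z&\text{if }q=\infty,\\[2mm]\displaystyle\sup_{z\in[t,1)}\frac{z^{s/Q}}{\phi_{X^{(\alpha)}}(z)}&\text{if }0<q\le\alpha\end{cases}$$ (with $z>0$ in the supremum when $t=0$). Then, for $f\in L^\alpha(\Omega)+L^\infty(\Omega)$: (1) If $m(0)<\infty$, then $\|f\|_{L^\infty}\preceq\|f\|_{\dot B^s_{X^{(\alpha)},q}}+\|f\|_{L^\alpha+L^\infty}$. (2) If $m(0)=\infty$, then: (a) if $\alpha<q<\infty$, $$\left(\int_0^1f^*(t)^q\frac{|m'(t)|}{(1+m(t))^{q/\alpha}}\,dt\right)^{1/q}\preceq\|f\|_{\dot B^s_{X^{(\alpha)},q}}+\|f\|_{L^\alpha+L^\infty};$$ (b) if $q=\infty$, $$\sup_{0<t\le1}\frac{f^*(t)}{(1+m(t))^{1/\alpha}}\preceq\|f\|_{\dot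 B^s_{X^{(\alpha)},\infty}}+\|f\|_{L^\alpha+L^\infty};$$ (c) if $0<q\le\alpha$, then for any weight $u$ such that $\int_0^tu^q(z)\frac{dz}z\preceq v^q(t)$ for $0<t<1$, where $v(t)=\phi_{X^{(\alpha)}}(t)\,t^{-s/Q}$, there is a positive constant $C$ such that $$\left(\int_0^1(f^*(t)u(t))^q\frac{dt}t\right)^{1/q}\le C\left(\|f\|_{\dot B^s_{X^{(\alpha)},q}}+\|f\|_{L^\alpha+L^\infty}\right).$$
   Context: $A\preceq B$ means $A\le cB$ for a constant $c>0$ independent of $f$ (and of $t$). A weight is a positive locally integrable function on $(0,\infty)$. Doubling metric measure space: $(\Omega,d)$ is a metric space, $B(x,r)=\{y\in\Omega: d(x,y)<r\}$, and $\mu$ is a Borel measure with $0<\mu(B)<\infty$ for every ball $B$, such that for some $C>1$ one has $\mu(B(x,2r))\le C\mu(B(x,r))$ for all $x\in\Omega$, $r>0$; the smallest such $C$ is $C_\mu$, and $Q=\log_2C_\mu$ is the upper dimension. Standing assumptions: $\mu(\Omega)=\infty$ and $\mu(\{x\})=0$ for all $x\in\Omega$. For measurable $f$, $f^*(t)=\inf\{\sigma\ge0:\mu\{|f|>\sigma\}\le t\}$. $\|f\|_{L^\alpha+L^\infty}$ is the usual sum quasi-norm $\inf\{\|f_0\|_{L^\alpha}+\|f_1\|_{L^\infty}:f=f_0+f_1\}$. An r.i. space $X$ on $\Omega$ is a subspace of $L^0(\Omega)$ (measurable functions with the topology of local convergence in measure) with a norm $\|\cdot\|_X$ such that: $X$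 is complete; $X\hookrightarrow L^0$ is continuous; $\chi_E\in X$ whenever $\mu(E)<\infty$; if $0\le f_n\nearrow f$ a.e. and $f\in X$ then $\|f_n\|_X\nearrow\|f\|_X$; and $\|f\|_X=\|g\|_X$ whenever $f^*=g^*$. $X^{(\alpha)}=\{f:|f|^\alpha\in X\}$ with $\|f\|_{X^{(\alpha)}}=\||f|^\alpha\|_X^{1/\alpha}$. The fundamental function is $\phi_X(t)=\|\chi_E\|_X$ for any $E$ with $\mu(E)=t$ and $\phi_{X^{(\alpha)}}=\phi_X^{1/\alpha}$; by renorming, $\phi_X$ is always assumed concave. Besov seminorm: $\nabla_r^\alpha f(x)=\left(\frac1{\mu(B(x,r))}\int_{B(x,r)}|f(x)-f(y)|^\alpha d\mu(y)\right)^{1/\alpha}$, $E_{X^{(\alpha)}}(f,r)=\|\nabla_r^\alpha f\|_{X^{(\alpha)}}$, and $\|f\|_{\dot B^s_{X^{(\alpha)},q}}=\left(\int_0^\infty(r^{-s}E_{X^{(\alpha)}}(f,r))^q\frac{dr}r\right)^{1/q}$ (supremum over $r>0$ if $q=\infty$). *)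

(* Defs.v *)
From HB Require Import structures.
From mathcomp Require Import all_boot all_order all_algebra.
From mathcomp Require Import all_classical all_reals all_analysis.

Set Implicit Arguments.
Unset Strict Implicit.
Unset Printing Implicit Defensive.

Import Order.TTheory GRing.Theory Num.Theory.
Import numFieldNormedType.Exports.

Local Open Scope classical_set_scope.
Local Open Scope ring_scope.

(* A metric space with a sigma-algebra. Nothing ties the two together here:
   [doubling_space] below requires the sigma-algebra to be the Borel one. The
   base point inherited from [measurableType] only says that the space is not
   empty. *)
#[short(type="metricMeasurableType")]
HB.structure Definition MetricMeasurable (R : realType) (d : measure_display) :=
  {T of Metric R T & Measurable d T}.

Section spaces.
Context {R : realType} {d : measure_display} {T : metricMeasurableType R d}.
Variable mu : {measure set T -> \bar R}.
Local Open Scope ereal_scope.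

Definition doubling_constant (C : R) : Prop :=
  (1 < C)%R /\
  forall (x : T) (r : R), (0 < r)%R -> mu (ball x (2 * r)%R) <= C%:E * mu (ball x r).

Definition doubling_space : Prop :=
  [/\ (measurable : set (set T)) = <<s @open T >>,
      forall (x : T) (r : R), (0 < r)%R -> 0 < mu (ball x r) < +oo &
      exists C, doubling_constant C].

Definition upper_dimension : R := (ln (inf doubling_constant) / ln 2)%R.

Definition noncollapsing : Prop :=
  0 < ereal_inf (range (fun x : T => mu (ball x 1%R))).

(* Value +oo when the distribution function never drops to level t. *)
Definition rearrangement (f : T -> R) (t : R) : \bar R :=
  ereal_inf [set sigma%:E | sigma in
    [set sigma : R | (0 <= sigma)%R /\
                     mu [set x | (sigma < `|f x|)%R] <= t%:E]].

Definition sum_norm (alpha : R) (f : T -> R) : \bar R :=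
  ereal_inf [set z | exists f0 f1 : T -> R,
    [/\ measurable_fun [set: T] f0, measurable_fun [set: T] f1,
        f = (f0 \+ f1)%R &
        z = 'N[mu]_(alpha%:E)[EFin \o f0] + 'N[mu]_(+oo)[EFin \o f1]]].

Definition sum_space (alpha : R) : set (T -> R) :=
  [set f | measurable_fun [set: T] f /\ sum_norm alpha f < +oo].

Definition cvg_locally_in_measure (u : (T -> R)^nat) (f : T -> R) : Prop :=
  forall E : set T, measurable E -> mu E < +oo ->
  forall e : R, (0 < e)%R ->
    (fun n => mu (E `&` [set x | (e < `|u n x - f x|)%R])) @ \oo --> (0 : \bar R).

Definition nabla (alpha r : R) (f : T -> R) (x : T) : \bar R :=
  ((mu (ball x r))^-1 *
   \int[mu]_(y in ball x r) (`|f x - f y| `^ alpha)%:E) `^ alpha^-1.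

End spaces.

(* The elements are functions rather than classes modulo almost everywhere
   equality; the carrier is saturated for that equality by [ri_rearrangement].
   As usual the norm is thought of as +oo off the carrier, so [ri_fatou] and
   [ri_rearrangement] also assert membership. Since the norm topology is first
   countable, sequential continuity in [ri_continuous] is continuity. *)
Record ri_space (R : realType) (d : measure_display)
    (T : metricMeasurableType R d) (mu : {measure set T -> \bar R}) := RiSpace {
  ri_carrier : set (T -> R) ;
  ri_norm : (T -> R) -> R ;
  ri_measurable : forall f, ri_carrier f -> measurable_fun [set: T] f ;
  ri_carrier0 : ri_carrier (cst 0) ;
  ri_carrierP : forall (a : R) f g, ri_carrier f -> ri_carrier g ->
    ri_carrier (fun x => a * f x + g x) ;
  ri_norm_ge0 : forall f, ri_carrier f -> 0 <= ri_norm f ;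
  ri_norm_eq0 : forall f, ri_carrier f -> ri_norm f = 0 ->
    \forall x \ae mu, f x = 0 ;
  ri_normZ : forall (a : R) f, ri_carrier f ->
    ri_norm (fun x => a * f x) = `|a| * ri_norm f ;
  ri_normD : forall f g, ri_carrier f -> ri_carrier g ->
    ri_norm (f \+ g) <= ri_norm f + ri_norm g ;
  ri_complete : forall u : (T -> R)^nat, (forall n, ri_carrier (u n)) ->
    (forall e, 0 < e -> exists N : nat, forall m n : nat,
       (N <= m)%N -> (N <= n)%N -> ri_norm (u m \- u n) < e) ->
    exists2 f, ri_carrier f &
      (fun n => ri_norm (u n \- f)) @ \oo --> (0 : R) ;
  ri_continuous : forall (u : (T -> R)^nat) f,
    (forall n, ri_carrier (u n)) -> ri_carrier f ->
    (fun n => ri_norm (u n \- f)) @ \oo --> (0 : R) ->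
    cvg_locally_in_measure mu u f ;
  ri_indic : forall E : set T, measurable E -> (mu E < +oo)%E ->
    ri_carrier \1_E ;
  ri_fatou : forall (u : (T -> R)^nat) f,
    (forall n, measurable_fun [set: T] (u n)) -> ri_carrier f ->
    (\forall x \ae mu, [/\ forall n, 0 <= u n x,
       nondecreasing_seq (u^~ x) & (u^~ x) @ \oo --> f x]) ->
    [/\ forall n, ri_carrier (u n),
        nondecreasing_seq (fun n => ri_norm (u n)) &
        (fun n => ri_norm (u n)) @ \oo --> ri_norm f] ;
  ri_rearrangement : forall f g,
    ri_carrier f -> measurable_fun [set: T] g ->
    (forall t : R, 0 < t -> rearrangement mu f t = rearrangement mu g t) ->
    ri_carrier g /\ ri_norm f = ri_norm g
}.

Section besov.
Context {R : realType} {d : measure_display} {T : metricMeasurableType R d}.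
Context {mu : {measure set T -> \bar R}} (X : ri_space mu).
Local Open Scope ereal_scope.

(* The norm of X on extended real-valued functions, +oo off X. *)
Definition ri_enorm (g : T -> \bar R) : \bar R :=
  if `[< (\forall x \ae mu, g x \is a fin_num) /\ ri_carrier X (fine \o g) >]
  then (ri_norm X (fine \o g))%:E else +oo.

Definition power_norm (alpha : R) (g : T -> \bar R) : \bar R :=
  ri_enorm (fun x => `|g x| `^ alpha) `^ alpha^-1.

Definition modulus (alpha : R) (f : T -> R) (r : R) : \bar R :=
  power_norm alpha (nabla mu alpha r f).

Definition besov_seminorm (s alpha : R) (q : \bar R) (f : T -> R) : \bar R :=
  match q with
  | p%:E => (\int[lebesgue_measure]_(r in `]0%R, +oo[)
               (((r `^ (- s))%:E * modulus alpha f r) `^ p * (r^-1)%:E)) `^ p^-1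
  | +oo => ereal_sup [set (r `^ (- s))%:E * modulus alpha f r |
                        r in `]0%R, +oo[]
  | -oo => 0
  end.

(* The set E is an arbitrary one of measure t. *)
Definition fundamental (t : R) : R :=
  ri_norm X \1_(xget set0 [set E : set T | measurable E /\ mu E = t%:E]).

Definition power_fundamental (alpha t : R) : R := fundamental t `^ alpha^-1.

(* The function m of the embedding criterion. The supremum is taken in
   [0, +oo], whence the [maxe 0]: it is over the empty set when t = 1. *)
Definition embedding_fun (s alpha : R) (q : \bar R) (t : R) : \bar R :=
  let Q := upper_dimension mu in
  let h z := (z `^ (s / Q) / power_fundamental alpha z)%R in
  match q with
  | p%:E =>
      if (alpha < p)%R then
        \int[lebesgue_measure]_(z in `[t, 1%R])
          (h z `^ (alpha * p / (p - alpha)) / z)%:E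
      else maxe 0 (ereal_sup [set (h z)%:E | z in
             [set z : R | (t <= z < 1)%R /\ (0 < z)%R]])
  | _ => \int[lebesgue_measure]_(z in `[t, 1%R]) (h z `^ alpha / z)%:E
  end.

End besov.

Definition weight (R : realType) (u : R -> R) : Prop :=
  (forall t, 0 < t -> 0 < u t) /\ locally_integrable `]0, +oo[%classic u.

(* Main.v *)
Require Import Defs.
From mathcomp Require Import all_boot all_order all_algebra.
From mathcomp Require Import all_classical all_reals all_analysis.
From mathcomp Require Import measurable_realfun ess_sup_inf ring lra.

Import Order.TTheory GRing.Theory Num.Theory.
Import numFieldNormedType.Exports.

Local Open Scope classical_set_scope.
Local Open Scope ring_scope.

(** Write F for the decreasing rearrangement of f, phi for the fundamental
function of X^(alpha), C for the doubling constant, and let b <= 1 bound the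
measures of all unit balls from below. Doubling gives mu (B(x, r)) >= 2 t_k as
soon as r >= 2^-k, where t_k = (b/2) C^-k is of the order of 2^(-k Q). At most
t_k of such a ball can lie where |f| exceeds F(t_k), so for at least half of
the points y of B(x, r) one has |f y| <= F(t_k), and averaging over those y
alone gives the pointwise estimate
  (|f x| - F(t_k))_+ <= 2^(1/alpha) nabla_r f (x).
On a set of measure at least t_(k+1) the left side is no less than
F(t_(k+1)) - F(t_k). The norm of X is monotone (a consequence of the Fatou
property) and depends only on rearrangements, hence
  (F(t_(k+1)) - F(t_k)) phi(t_(k+1)) <= 2^(1/alpha) E(f, r),   r >= 2^-k,
which is [modulus_ge_jump].

The rest is about sequences. Put h_k = 2^(-k s) / phi(t_(k+1)) and
g_k = (F(t_(k+1)) - F(t_k)) / h_k. Integrating the last inequality over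
2^-k <= r < 2^(1-k) bounds the l^q norm of g by the Besov seminorm
([sum_jump_ratio_le], [jump_ratio_le]), and F(t_0) is bounded by the norm of f
in L^alpha + L^oo ([rearrangement_le_sum_norm]). As phi is a power of a concave
increasing function, it varies by a bounded factor on each cell
[t_(k+1), t_k). With gam the exponent in the integral that defines m,
1 + m(t) is therefore comparable with 1 + sum_(j <= k) h_j^gam on this cell,
and |m'(t)| is at most a constant times h_k^gam / t_k. Finally alpha <= 1 gives
  F(t_N)^alpha <= F(t_0)^alpha + sum_(k < N) (h_k g_k)^alpha,
and each part of the theorem estimates the last sum in its own way:
 - when m(0) is finite, Young's inequality (alpha < q), the bound on g
   (q = oo) or the inclusion of l^q in l^alpha (q <= alpha) bounds it
   independently of N;
 - for q = oo the sum up to the cell of t is at most a constant times 1 + m(t);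
 - for alpha < q < oo the claim is a Hardy inequality for sums with weights
   h_k^gam, proved by Elliott's method ([discrete_hardy]);
 - for q <= alpha one uses the exponent q instead of alpha, writes F^q as a
   combination of indicators of the intervals (0, t_j), and applies the
   hypothesis on the weight u at t = t_j.

The function r |-> E(f, r) may fail to be measurable. The integral of a
nonnegative function is a supremum over the simple functions below it and so is
monotone for all nonnegative functions; the integral that defines the Besov
seminorm is only compared with those of step functions. *)

(** * Power functions and the discrete Hardy inequality *)

Section powers.
Context {R : realType}.
Implicit Types a b p x y : R.

(** With z / (x + y) in [0, 1] one has z / (x + y) <= (z / (x + y))^a, because
a <= 1; adding this for z = x and z = y gives the claim. *)
Lemma powR_subadditive a x y : 0 < a <= 1 -> 0 <= x -> 0 <= y ->
  (x + y) `^ a <= x `^ a + y `^ a.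
Proof.
move=> /andP[a0 a1] x0 y0.
have [xy0|xyN0] := eqVneq (x + y) 0.
  by rewrite xy0 powR0 ?gt_eqF// addr_ge0 ?powR_ge0.
have xy : 0 < x + y by rewrite lt_neqAle eq_sym xyN0 addr_ge0.
have xy' := ltW xy.
have frac (z : R) : 0 <= z -> z <= x + y ->
    z / (x + y) * (x + y) `^ a <= z `^ a.
  move=> z0 zxy; rewrite -[X in _ <= X `^ a](divfK xyN0 z).
  rewrite [leRHS]powRM ?divr_ge0//.
  rewrite ler_wpM2r ?powR_ge0//.
  have [->|zN0] := eqVneq z 0; first by rewrite mul0r powR0// gt_eqF.
  apply: ger1_powR => //.
  by rewrite ler_pdivrMr// mul1r zxy divr_gt0// lt0r zN0.
rewrite -[leLHS]mul1r -[X in X * _](divff xyN0) mulrDl mulrDl.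
by apply: lerD; apply: frac; rewrite // ?lerDl ?lerDr.
Qed.

Lemma powR_young p x y : 1 < p -> 0 <= x -> 0 <= y ->
  x * y `^ (p - 1) <= x `^ p / p + y `^ p * ((p - 1) / p).
Proof.
move=> p1 x0 y0; have p0 : 0 < p by apply: lt_trans p1.
have q0 : 0 < p / (p - 1) by rewrite divr_gt0// subr_gt0.
have pm : p - 1 != 0 by rewrite gt_eqF// subr_gt0.
have := @conjugate_powR R x (y `^ (p - 1)) p (p / (p - 1)) x0 (powR_ge0 _ _) p0 q0.
rewrite -powRrM invf_div [(p - 1) * _]mulrC divfK//; apply.
by field; rewrite gt_eqF.
Qed.

(** Young's inequality for 2x and y. The factor 2 makes the coefficient of y^p
equal to 1/2, so that this term can be absorbed. *)
Lemma powR_young2 p x y : 1 < p -> 0 <= x -> 0 <= y ->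
  p / (p - 1) * (x * y `^ (p - 1)) <=
  2 `^ (p - 1) / (p - 1) * x `^ p + y `^ p / 2.
Proof.
move=> p1 x0 y0; have p0 : 0 < p by apply: lt_trans p1.
have pm : 0 < p - 1 by rewrite subr_gt0.
have := @powR_young p (2 * x) y p1 (mulr_ge0 (ler0n R 2) x0) y0.
rewrite powRM// -(@mulr_powRB1 _ 2 p)//.
set u := 2 `^ _; set v := x `^ p; set w := y `^ p; set z := y `^ _ => H.
have := ler_wpM2l (ltW (divr_gt0 p0 (mulr_gt0 (ltr0n R 2) pm))) H.
set lhs1 := (X in X <= _ -> _); set lhs2 := (X in _ <= X -> _) => H1.
suff: p / (p - 1) * (x * z) = lhs1 /\ u / (p - 1) * v + w / 2 = lhs2.
  by move=> [-> ->].
by rewrite /lhs1 /lhs2; split; field; rewrite ?gt_eqF.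
Qed.

(** Elliott's proof of Hardy's inequality. M and B are the partial sums of the
weights w and of w b, with initial values M 0 and B 0. Each term of the left
side is bounded by a multiple of the corresponding term of the right side plus
a telescoping difference, so no sum has to be interchanged. The initial value
B 0 carries the part of a sequence that does not come from the sum. *)
Section hardy.
Variables (p : R) (w b M B : nat -> R).
Hypotheses (p1 : 1 < p) (w0 : forall k, 0 <= w k) (b0 : forall k, 0 <= b k).
Hypotheses (M0 : 0 < M 0%N) (B0 : 0 <= B 0%N).
Hypotheses (MS : forall k, M k.+1 = M k + w k)
           (BS : forall k, B k.+1 = B k + w k * b k).

Let A k := B k / M k.

Let M_gt0 k : 0 < M k.
Proof. by elim: k => // k IH; rewrite MS ltr_wpDr. Qed.

Let A_ge0 k : 0 <= A k.
Proof.
apply: divr_ge0; last exact/ltW.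
by elim: k => // k IH; rewrite BS addr_ge0// mulr_ge0.
Qed.

Let step k : w k * A k.+1 `^ p / 2 <= 2 `^ (p - 1) / (p - 1) * (w k * b k `^ p)
  + (M k * A k `^ p - M k.+1 * A k.+1 `^ p) / (p - 1).
Proof.
have p0 : 0 < p by apply: lt_trans p1.
have pm : 0 < p - 1 by rewrite subr_gt0.
have wb : w k * b k = M k.+1 * A k.+1 - M k * A k.
  by rewrite /A ![M _ * (_ / _)]mulrC !divfK ?gt_eqF// BS addrC addKr.
have Y1 := @powR_young p (A k) (A k.+1) p1 (A_ge0 _) (A_ge0 _).
have Y2 := @powR_young2 p (b k) (A k.+1) p1 (b0 _) (A_ge0 _).
have := ler_wpM2l (w0 k) Y2.
have := ler_wpM2l (ltW (mulr_gt0 (M_gt0 k) (divr_gt0 p0 pm))) Y1.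
have AA := @mulr_powRB1 _ (A k.+1) p (A_ge0 _) p0.
rewrite (_ : w k * (_ * (_ * _)) = p / (p - 1) * ((w k * b k) * A k.+1 `^ (p - 1)));
  last by ring.
rewrite wb [(M k.+1 * _ - _) * _]mulrBl -(mulrA (M k.+1)) AA -[M k * A k *
  _]mulrA MS.
set a0 := A k `^ p; set a1 := A k.+1 `^ p; set c := A k.+1 `^ _.
set u := 2 `^ _; set bp := b k `^ p => H1 H2.
have E1 : M k * (p / (p - 1)) * (a0 / p + a1 * ((p - 1) / p)) =
   M k * a0 / (p - 1) + M k * a1.
  by field; rewrite !gt_eqF.
have E2 : p / (p - 1) * ((M k + w k) * a1 - M k * (A k * c)) =
   (M k + w k) * a1 + (M k + w k) * a1 / (p - 1) - M k * (p / (p - 1)) * (A k * c).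
  by field; rewrite !gt_eqF.
rewrite E1 in H1; rewrite E2 in H2.
have E3 : w k * (u / (p - 1) * bp + a1 / 2) = u / (p-1) * (w k * bp) + w k * a1 / 2.
  by ring.
rewrite E3 in H2; rewrite mulrBl; lra.
Qed.

Lemma discrete_hardy N :
  \sum_(k < N) w k * (B k.+1 / M k.+1) `^ p <=
  2 / (p - 1) * (2 `^ (p - 1) * \sum_(k < N) w k * b k `^ p +
                 M 0%N * (B 0%N / M 0%N) `^ p).
Proof.
have p0 : 0 < p by apply: lt_trans p1.
have pm : 0 < p - 1 by rewrite subr_gt0.
suff H : \sum_(k < N) w k * A k.+1 `^ p / 2 <=
    2 `^ (p - 1) / (p - 1) * \sum_(k < N) w k * b k `^ p +
    (M 0%N * A 0%N `^ p - M N * A N `^ p) / (p - 1).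
  have H3 : 0 <= M N * A N `^ p / (p - 1).
    by rewrite divr_ge0 ?mulr_ge0 ?powR_ge0//; exact: ltW.
  rewrite -mulr_suml in H; rewrite mulrBl in H.
  rewrite (_ : 2 / (p - 1) * _ = 2 * (2 `^ (p - 1) / (p - 1) *
    \sum_(k < N) w k * b k `^ p + M 0%N * A 0%N `^ p / (p - 1))); last first.
    by rewrite /A; field; rewrite gt_eqF.
  rewrite -/(A _); lra.
elim: N => [|N IH].
  by rewrite !big_ord0 subrr mul0r mulr0 addr0.
rewrite !big_ord_recr/=.
have := lerD IH (step N) => /le_trans; apply.
by rewrite mulrDr !mulrBl; lra.
Qed.

End hardy.

End powers.

(** * Comparison of integrals with step functions *)

Section nonmeasurable_integral.
Local Open Scope ereal_scope.
Context {d : measure_display} {T : measurableType d} {R : realType}.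
Variable nu : {measure set T -> \bar R}.

(** The integral of a nonnegative function is a supremum over the simple
functions below it. *)
Lemma ge0_le_integral_nonmeas (D : set T) (f1 f2 : T -> \bar R) :
  (forall x, D x -> 0 <= f1 x) -> (forall x, D x -> f1 x <= f2 x) ->
  \int[nu]_(x in D) f1 x <= \int[nu]_(x in D) f2 x.
Proof.
move=> f10 f12.
have f20 x : D x -> 0 <= f2 x by move=> Dx; exact: le_trans (f10 _ Dx) (f12 _ Dx).
rewrite !ge0_integralE// ge_ereal_sup// => _ [h/= hf] <-.
apply: ereal_sup_ubound; exists h => // x; apply: le_trans (hf x) _.
exact: lee_restrict.
Qed.

Let integral_step (D A : set T) (c : R) : measurable D -> measurable A ->
  (0 <= c)%R -> \int[nu]_(x in D) (c%:E * (\1_A x)%:E) = c%:E * nu (A `&` D).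
Proof.
move=> mD mA c0; rewrite ge0_integralZl ?lee_fin// ?integral_indic//.
exact/measurable_EFinP/measurable_indic.
Qed.

Lemma mul_measure_le_integral (D A : set T) (c : R) (F : T -> \bar R) :
  measurable D -> measurable A -> A `<=` D -> (0 <= c)%R ->
  (forall x, D x -> 0 <= F x) -> (forall x, A x -> c%:E <= F x) ->
  c%:E * nu A <= \int[nu]_(x in D) F x.
Proof.
move=> mD mA AD c0 F0 cF; rewrite -[A in nu A](setIidl AD) -integral_step//.
apply: ge0_le_integral_nonmeas => x Dx; first by rewrite mule_ge0// lee_fin.
by rewrite indicE; case: (boolP (x \in A)) => [/set_mem/cF|_];
  rewrite ?mule1 ?mule0 ?F0.
Qed.

Lemma sum_le_integral (D : set T) (A : nat -> set T) (c : nat -> R)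
    (F : T -> \bar R) (N : nat) :
  measurable D -> (forall k, measurable (A k)) ->
  (forall k, (k < N)%N -> A k `<=` D) ->
  trivIset setT A -> (forall k, (0 <= c k)%R) ->
  (forall x, D x -> 0 <= F x) ->
  (forall k x, (k < N)%N -> A k x -> (c k)%:E <= F x) ->
  \sum_(k < N) (c k)%:E * nu (A k) <= \int[nu]_(x in D) F x.
Proof.
move=> mD mA AD tA c0 F0 cF.
have E (k : 'I_N) :
    (c k)%:E * nu (A k) = \int[nu]_(x in D) ((c k)%:E * (\1_(A k) x)%:E).
  by rewrite integral_step// setIidl//; exact: AD.
under eq_bigr do rewrite E.
rewrite -(@ge0_integral_sum _ _ _ nu D mD 'I_N
  (fun k x => (c k)%:E * (\1_(A k) x)%:E))//; last 2 first.
- by move=> k; apply/measurable_EFinP/measurable_funM => //;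
    exact: measurable_indic.
- by move=> k x _; rewrite mule_ge0// lee_fin.
apply: ge0_le_integral_nonmeas => x Dx.
  by apply: sume_ge0 => k _; rewrite mule_ge0// lee_fin.
have [[i Aix]|noA] := pselect (exists i : 'I_N, A i x); last first.
  rewrite big1 ?F0// => k _; rewrite indicE memNset ?mule0// => Akx.
  by apply: noA; exists k.
rewrite (bigD1 i)//= big1 ?adde0.
  by rewrite indicE mem_set// mule1 (cF i).
move=> j ji; rewrite indicE memNset ?mule0// => Ajx; move/eqP : ji; apply.
by apply/val_inj/(tA j i) => //; exists x.
Qed.

Lemma integral_le_nneseries (D : set T) (A : nat -> set T) (c : nat -> R)
    (F : T -> \bar R) :
  measurable D -> (forall k, measurable (A k)) -> D `<=` \bigcup_k A k ->
  (forall k, (0 <= c k)%R) -> (forall x, D x -> 0 <= F x) ->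
  (forall k x, D x -> A k x -> F x <= (c k)%:E) ->
  \int[nu]_(x in D) F x <= \sum_(k <oo) (c k)%:E * nu (A k).
Proof.
move=> mD mA DA c0 F0 Fc.
have st0 k x : 0 <= (c k)%:E * (\1_(A k) x)%:E by rewrite mule_ge0// lee_fin.
apply: (@le_trans _ _ (\int[nu]_(x in D)
    \sum_(k <oo) ((c k)%:E * (\1_(A k) x)%:E))).
  apply: ge0_le_integral_nonmeas => // x Dx.
  have [k _ Akx] := DA _ Dx; apply: le_trans (Fc k x Dx Akx) _.
  apply: le_trans (nneseries_lim_ge k.+1 _) => //.
  rewrite big_nat_recr//= indicE mem_set// mule1 leeDr//.
  by apply: sume_ge0 => i _; exact: st0.
rewrite integral_nneseries//; last first.
  by move=> k; apply/measurable_EFinP/measurable_funM => //;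
    exact: measurable_indic.
apply: lee_nneseries => k _ *.
  by apply: integral_ge0 => x _; exact: st0.
rewrite integral_step// lee_wpmul2l ?lee_fin// le_measure// ?inE//.
exact: measurableI.
Qed.

End nonmeasurable_integral.

Definition scale {R : realType} (beta lam : R) (k : nat) : R := beta * lam ^+ k.

Section scales.
Context {R : realType}.
Variables (beta lam : R).
Hypotheses (beta0 : 0 < beta) (lam0 : 0 < lam) (lam1 : lam < 1).

Local Notation tau := (scale beta lam).

Lemma scale0 : tau 0 = beta. Proof. by rewrite /scale expr0 mulr1. Qed.

Lemma scale_gt0 k : 0 < tau k. Proof. by rewrite mulr_gt0// exprn_gt0. Qed.

(** k + 1 is the least n with [tau n <= t]. *)
Lemma scale_cell (t : R) : 0 < t < beta ->
  exists k, tau k.+1 <= t < tau k.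
Proof.
move=> /andP[t0 tb].
have /cvgrPdist_lt/(_ (t / beta)) : (lam ^+ n) @[n --> \oo] --> (0 : R).
  by apply: cvg_expr; rewrite gtr0_norm.
have tb0 : 0 < t / beta by rewrite divr_gt0.
move=> /(_ tb0) [n _ /(_ n (leqnn n))].
rewrite sub0r normrN gtr0_norm ?exprn_gt0// ltr_pdivlMr// mulrC => nt.
have ex : exists n, tau n <= t by exists n; exact: ltW.
case: (ex_minnP ex) => -[|m] mt mmin.
  by move: mt; rewrite /scale expr0 mulr1 leNgt tb.
exists m; rewrite mt/= ltNge; apply/negP => /mmin; by rewrite ltnn.
Qed.

Lemma scale_le k l : (k <= l)%N -> tau l <= tau k.
Proof.
move=> kl; rewrite ler_pM2l// ler_wiXn2l//; exact: ltW.
Qed.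

Lemma scale_trivIset : trivIset setT (fun k => `[tau k.+1, tau k[%classic).
Proof.
move=> i j _ _ [t []] /=; rewrite !in_itv/= => /andP[it ti] /andP[jt tj].
apply/eqP; rewrite eqn_leq; apply/andP; split; rewrite leqNgt; apply/negP.
- move=> /scale_le ij; have := lt_le_trans ti ij.
  by rewrite ltNge jt.
- move=> /scale_le ij; have := lt_le_trans tj ij.
  by rewrite ltNge it.
Qed.

Lemma lebesgue_measure_scale k :
  lebesgue_measure `[tau k.+1, tau k[%classic = (tau k * (1 - lam))%:E.
Proof.
rewrite lebesgue_measure_itv/= lte_fin; case: ifPn => [_|].
  by rewrite /scale exprS; congr EFin; ring.
by rewrite /scale exprS mulrCA gtr_pMl ?lam1// mulr_gt0// exprn_gt0.
Qed.

End scales.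

(** * Rearrangement invariant norms and the fundamental function *)

Section ri_space_theory.
Context {R : realType} {d : measure_display} {T : metricMeasurableType R d}.
Context {mu : {measure set T -> \bar R}} (X : ri_space mu).

Lemma indic_level (E : set T) (sigma : R) : 0 <= sigma ->
  [set x | sigma < `|\1_E x : R|] = if sigma < 1 then E else set0.
Proof.
move=> s0; apply/seteqP; split => x /=.
  rewrite indicE; case: (boolP (x \in E)) => [xE|_].
    by rewrite normr1 => ->; exact/set_mem.
  by rewrite normr0 ltNge s0.
by case: ifPn => // s1 Ex; rewrite indicE mem_set// normr1.
Qed.

Lemma ri_norm_indic_eq (E F : set T) : measurable E -> measurable F ->
  (mu E < +oo)%E -> mu E = mu F -> ri_norm X \1_E = ri_norm X \1_F.
Proof.
move=> mE mF Eoo EF; apply: (ri_rearrangement (ri_indic X mE Eoo) _ _).2.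
  exact: measurable_indic.
move=> t t0; congr ereal_inf; apply/seteqP.
by split => _ [s [s0 +] <-] => /[!indic_level]// H; exists s => //; split => //;
  rewrite indic_level//; move: H; case: ifPn; rewrite ?EF.
Qed.

Lemma ri_norm_indic_gt0 (E : set T) : measurable E ->
  (0 < mu E < +oo)%E -> 0 < ri_norm X \1_E.
Proof.
move=> mE /andP[E0 Eoo]; have cE := ri_indic X mE Eoo.
rewrite lt_neqAle ri_norm_ge0// andbT eq_sym; apply/eqP => /(ri_norm_eq0 cE).
move=> [N [mN N0 EN]]; move: E0; rewrite lt0e => /andP[/eqP + _]; apply.
apply/eqP; rewrite eq_le measure_ge0 andbT -N0 le_measure ?inE//.
move=> x Ex; apply: EN => /=; rewrite indicE mem_set// => /eqP.
by rewrite oner_eq0.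
Qed.

(** The sequence h, g, g, ... increases to g almost everywhere, so the Fatou
property yields both membership and monotonicity of the norm. *)
Lemma ri_lattice (g h : T -> R) : ri_carrier X g -> measurable_fun setT h ->
  (forall x, 0 <= h x) -> (\forall x \ae mu, h x <= g x) ->
  ri_carrier X h /\ ri_norm X h <= ri_norm X g.
Proof.
move=> cg mh h0 hg.
have [||cu nd _] := @ri_fatou _ _ _ _ X (fun n => if n is 0%N then h else g) g _ cg.
- by case=> // n; exact: ri_measurable cg.
- apply: filterS hg => x hgx; split.
  + by case=> // n; exact: le_trans (h0 x) hgx.
  + by case=> [|n] [|m].
  + rewrite -cvg_shiftS; exact: cvg_cst.
- by split; [exact: (cu 0%N)|exact: (nd 0%N 1%N)].
Qed.

Lemma fundamentalE (E : set T) (t : R) : measurable E -> mu E = t%:E ->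
  fundamental X t = ri_norm X \1_E.
Proof.
move=> mE Et; rewrite /fundamental.
have [|mF Ft] := @xgetPex _ set0 [set E : set T | measurable E /\ mu E = t%:E].
  by exists E.
by apply: ri_norm_indic_eq => //; rewrite Ft ?ltry// Et.
Qed.

(** The set chosen by [fundamental] has finite measure in any case: it is empty
when no set of measure t exists. *)
Lemma fundamental_ge0 (t : R) : 0 <= fundamental X t.
Proof.
apply: ri_norm_ge0; case: xgetP => [F _ [mF Ft]|_]; apply: ri_indic => //.
  by rewrite Ft ltry.
by rewrite measure0.
Qed.

Hypothesis concave_phi :
  @convex_function R R^o `]0%R, +oo[ (fun t => (- fundamental X t)%R).

Lemma fundamental_concave (z1 z2 l : R) : 0 < z1 -> 0 < z2 -> 0 <= l <= 1 ->
  l * fundamental X z1 + (1 - l) * fundamental X z2 <=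
  fundamental X (l * z1 + (1 - l) * z2).
Proof.
move=> z10 z20 l01.
have ll : Itv.spec (@Itv.num_sem R) (Itv.Real `[0%Z, 1%Z]) l.
  by rewrite /= /Itv.num_sem in_itv/= realE l01; case/andP: l01 => ->.
have := concave_phi (Itv.mk ll) z1 z2.
rewrite !inE/= !in_itv/= !andbT => /(_ z10 z20).
by rewrite !convRE/= -lerN2 opprK !mulrN opprD !opprK; apply.
Qed.

(** A concave function on a half-line that is bounded below cannot decrease: a
drop from z1 to z2 would force arbitrarily negative values further on. *)
Lemma fundamental_nondecreasing (z1 z2 : R) : 0 < z1 -> z1 <= z2 ->
  fundamental X z1 <= fundamental X z2.
Proof.
move=> z10; rewrite le_eqVlt => /predU1P[->//|z12].
rewrite leNgt; apply/negP => phi21.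
pose f1 := fundamental X z1; pose f2 := fundamental X z2.
have f20 : 0 <= f2 by exact: fundamental_ge0.
have f12 : 0 < f1 - f2 by rewrite subr_gt0.
have f10 : 0 < f1 by apply: le_lt_trans phi21.
pose e := (f1 - f2) / (2 * f1).
have e0 : 0 < e by rewrite divr_gt0// mulr_gt0.
have e1 : e < 1 by rewrite ltr_pdivrMr ?mulr_gt0//; lra.
(* z2 = (1 - e) z1 + e z3, and e f1 is half of the assumed drop f1 - f2 *)
pose z3 := z1 + (z2 - z1) / e.
have z30 : 0 < z3 by rewrite addr_gt0// divr_gt0// subr_gt0.
have := @fundamental_concave z1 z3 (1 - e) z10 z30.
rewrite (_ : (1 - e) * z1 + _ = z2); last by rewrite /z3; field; rewrite gt_eqF.
have -> : 0 <= 1 - e <= 1 by lra.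
move=> /(_ isT); apply/negP; rewrite -ltNge.
have f30 : 0 <= (1 - (1 - e)) * fundamental X z3.
  by rewrite mulr_ge0 ?fundamental_ge0//; lra.
have : (1 - e) * f1 = f1 - (f1 - f2) / 2 by rewrite /e; field; rewrite gt_eqF.
rewrite -/f1 -/f2; lra.
Qed.

(** z1 is a convex combination of z2 and z1 / 2 in which z2 has weight at
least 1 / (2 c). *)
Lemma fundamental_growth (c z1 z2 : R) : 0 < z1 -> z1 <= z2 -> z2 <= c * z1 ->
  fundamental X z2 <= 2 * c * fundamental X z1.
Proof.
move=> z10 z12 z2c.
have d0 : 0 < z2 - z1 / 2 by lra.
pose l := (z1 / 2) / (z2 - z1 / 2).
have l0 : 0 < l by rewrite /l !divr_gt0.
have l1 : l <= 1 by rewrite ler_pdivrMr//; lra.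
have := @fundamental_concave z2 (z1 / 2) l (lt_le_trans z10 z12).
rewrite divr_gt0// => /(_ isT).
rewrite (ltW l0) l1 => /(_ isT).
rewrite (_ : l * z2 + _ = z1); last by rewrite /l; field; rewrite gt_eqF//; lra.
have := fundamental_ge0 (z1 / 2).
move=> fz h; have {}h : l * fundamental X z2 <= fundamental X z1.
  by apply: le_trans h; rewrite lerDl mulr_ge0// subr_ge0.
have c0 : 0 < c by rewrite -(pmulr_lgt0 _ z10) (lt_le_trans _ z2c)//
  (lt_le_trans z10).
rewrite -ler_pdivrMl ?mulr_gt0//; apply: le_trans h.
rewrite ler_wpM2r ?fundamental_ge0// /l ler_pdivlMr//.
rewrite invfM -mulrA ler_pdivrMl// ler_pdivrMl//; nra.
Qed.

Hypothesis nontrivial : exists2 E, measurable E & (0 < mu E < +oo)%E.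

(** One set of positive finite measure suffices. Positivity at its measure
spreads to smaller arguments by [fundamental_growth]; in particular sets of
every measure t > 0 exist, since otherwise the value at t would be 0. *)
Lemma fundamental_gt0 (t : R) : 0 < t -> 0 < fundamental X t.
Proof.
have [E mE /andP[E0 Eoo]] := nontrivial.
have muE : mu E = (fine (mu E))%:E by rewrite fineK// ge0_fin_numE.
have e0 : 0 < fine (mu E) by rewrite fine_gt0// E0.
have fe0 : 0 < fundamental X (fine (mu E)).
  by rewrite (@fundamentalE E _ mE muE) ri_norm_indic_gt0// E0.
move=> t0; have [et|te] := leP (fine (mu E)) t.
  by apply: lt_le_trans fe0 _; exact: fundamental_nondecreasing.
have := @fundamental_growth (fine (mu E) / t) t (fine (mu E)) t0 (ltW te).
rewrite divfK ?gt_eqF// lexx => /(_ isT) /(lt_le_trans fe0).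
by rewrite pmulr_rgt0// mulr_gt0// divr_gt0.
Qed.

End ri_space_theory.

(** * Doubling measures and the basic oscillation estimate *)

Section doubling.
Context {R : realType} {d : measure_display} {T : metricMeasurableType R d}.
Context {mu : {measure set T -> \bar R}}.
Hypothesis doubling_mu : doubling_space mu.

Let mballE (x : T) (r : R) (y : T) : ball x r y = (mdist x y < r) :> Prop.
Proof. exact: (congr1 (fun A : set T => A y) (ballEmdist x r)). Qed.

(** The sigma-algebra is generated by the open sets, and balls of a metric are
open by the triangle inequality. *)
Lemma measurable_mball (x : T) (r : R) : measurable (ball x r).
Proof.
have [-> _ _] := doubling_mu; apply: sub_sigma_algebra.
rewrite /= openE => y; rewrite mballE => xyr.
rewrite /interior; apply/nbhs_ballP; exists (r - mdist x y); rewrite /= ?subr_gt0//.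
move=> z; rewrite !mballE ltrBrDl => yzr.
apply: le_lt_trans yzr; exact: metric_triangle.
Qed.

Lemma mu_ball_EFin (x : T) (r : R) : 0 < r ->
  exists2 m : R, 0 < m & mu (ball x r) = m%:E.
Proof.
have [_ + _] := doubling_mu => /[apply] /(_ x) /andP[m0 moo].
exists (fine (mu (ball x r))); first by rewrite fine_gt0// m0.
by rewrite fineK// ge0_fin_numE// ltW.
Qed.

(** The space is a countable union of balls; this replaces a set of infinite
measure by one of finite measure in [modulus_ge]. *)
Lemma le_mu_exhaust (A : set T) (t : R) : measurable A ->
  (forall n : nat, (mu (A `&` ball point n.+1%:R) <= t%:E)%E) ->
  (mu A <= t%:E)%E.
Proof.
move=> mA At.
have mAn n : measurable (A `&` ball point n.+1%:R).
  by apply: measurableI => //; exact: measurable_mball.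
have bA : \bigcup_n (A `&` ball point n.+1%:R) = A.
  rewrite -setI_bigcupr setIidl// => x _.
  exists (Num.trunc (mdist point x)) => //; rewrite mballE.
  by rewrite truncnS_gt.
have ndA : nondecreasing_seq (fun n : nat => A `&` ball point n.+1%:R).
  move=> m n mn; apply/subsetPset; apply: setIS; apply: le_ball.
  by rewrite ler_nat.
have := @nondecreasing_cvg_mu _ _ _ mu _ mAn _ ndA; rewrite bA => /(_ mA)
  /cvge_to_le.
by apply; apply: nearW.
Qed.

Local Notation C := (inf (doubling_constant mu)).

(** The infimum of the doubling constants is itself admissible, because it is
compared with finite measures. *)
Lemma inf_doubling_constant (x : T) (r : R) : 0 < r ->
  (mu (ball x (2 * r)) <= C%:E * mu (ball x r))%E.
Proof.
move=> r0; have [m m0 rm] := mu_ball_EFin x r r0.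
have [m' m'0 rm'] := mu_ball_EFin x _ (mulr_gt0 (ltr0n R 2) r0).
rewrite rm rm' -EFinM lee_fin; apply/ler_addgt0Pl => e e0.
have em : 0 < e / m by rewrite divr_gt0.
have [_ _ [C0 HC0]] := doubling_mu.
have hi : has_inf (doubling_constant mu).
  by split; [exists C0|exists 1 => c [/ltW]].
have [c [_ /(_ x r r0) + cC]] := inf_adherent em hi.
rewrite rm rm' -EFinM lee_fin => /le_trans; apply.
rewrite addrC -(divfK (lt0r_neq0 m0) e) -mulrDl.
by rewrite ler_pM2r// ltW.
Qed.

Lemma mu_ball_ge (b : R) (x : T) (k : nat) (r : R) : 0 < b ->
  (b%:E <= mu (ball x 1))%E -> 0 < C -> 2^-1 ^+ k <= r ->
  ((b * C^-1 ^+ k)%:E <= mu (ball x r))%E.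
Proof.
move=> b0 bx C0; elim: k r => [r|k IH r kr].
  rewrite !expr0 mulr1 => kr.
  apply: le_trans bx _; rewrite le_measure ?inE//; try exact: measurable_mball.
  exact: le_ball.
have r0 : 0 < r by apply: lt_le_trans kr; rewrite exprn_gt0// invr_gt0.
have := IH (2 * r); rewrite -ler_pdivrMl// -exprS => /(_ kr).
move=> /le_trans/(_ (inf_doubling_constant x r r0)).
have [m m0 ->] := mu_ball_EFin x r r0.
by rewrite -EFinM !lee_fin -ler_pdivrMl// exprS mulrCA.
Qed.

Hypothesis mu_infinite : mu [set: T] = +oo%E.

(** With constant 1 all balls around a point would have the measure of the unit
ball, and the whole space would have finite measure. *)
Lemma inf_doubling_constant_gt1 : 1 < C.
Proof.
rewrite ltNge; apply/negP => C1.
have [m m0 m1] := mu_ball_EFin point 1 ltr01.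
have H n : (mu (ball point (2 ^+ n : R)) <= m%:E)%E.
  elim: n => [|n IH]; first by rewrite expr0 m1.
  rewrite exprS; have n0 : 0 < 2 ^+ n :> R by rewrite exprn_gt0.
  apply: le_trans (inf_doubling_constant point _ n0) _.
  apply: le_trans IH; have [l l0 ->] := mu_ball_EFin point _ n0.
  by rewrite -EFinM lee_fin -[leRHS]mul1r ler_wpM2r// ltW.
suff : (+oo <= m%:E)%E by rewrite leye_eq.
rewrite -mu_infinite; apply: le_mu_exhaust => // n; rewrite setTI.
apply: le_trans (H n.+1); rewrite le_measure ?inE//; try exact: measurable_mball.
by apply: le_ball; rewrite -natrX ler_nat ltnW// ltn_expl.
Qed.

Lemma noncollapsingP : noncollapsing mu ->
  exists2 b : R, 0 < b <= 1 & forall x : T, (b%:E <= mu (ball x 1))%E.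
Proof.
rewrite /noncollapsing; set B := ereal_inf _ => B0.
have HB x : (B <= mu (ball x 1%R))%E by apply: ereal_inf_lbound; exists x.
exists (fine (Order.min B 1%E)) => [|x].
  have -> : (0 < fine (Order.min B 1%E))%R.
    by rewrite fine_gt0// lt_min B0 lte01/= gt_min ltry orbT.
  rewrite -lee_fin fineK ?ge_min ?lexx ?orbT//.
  rewrite ge0_fin_numE ?gt_min ?ltry ?orbT//.
  by rewrite le_min ltW// lee01.
apply: le_trans (HB x); rewrite fineK ?ge_min ?lexx//.
rewrite ge0_fin_numE ?gt_min ?ltry ?orbT//.
by rewrite le_min ltW// lee01.
Qed.

End doubling.

Definition superlevel {R : realType} {T : Type} (f : T -> R) (sigma : R) : set T :=
  [set x | (sigma < `|f x|)%R].

Section modulus_lower_bound.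
Context {R : realType} {d : measure_display} {T : metricMeasurableType R d}.
Context {mu : {measure set T -> \bar R}} (X : ri_space mu).
Hypothesis doubling_mu : doubling_space mu.
Hypothesis concave_phi :
  @convex_function R R^o `]0%R, +oo[ (fun t => (- fundamental X t)%R).

Lemma measurable_superlevel (f : T -> R) sigma : measurable_fun setT f ->
  measurable (superlevel f sigma).
Proof.
move=> mf; rewrite (_ : superlevel f sigma = (Num.norm \o f) @^-1` `]sigma, +oo[).
  rewrite -[X in measurable X]setTI.
  have mnf : measurable_fun setT (Num.norm \o f) by exact: measurableT_comp.
  exact: mnf measurableT _ (measurable_itv _).
by apply/seteqP; split => x /=; rewrite in_itv/= andbT.
Qed.

(** At most half of the ball lies in the superlevel set of [tau]; on the rest
|f x - f y| >= sigma - tau. *)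
Lemma average_ge (f : T -> R) (alpha sigma tau t r : R) (x : T) :
  0 < alpha -> measurable_fun setT f -> 0 <= tau -> tau < sigma -> 0 < r ->
  (mu (superlevel f tau) <= t%:E)%E -> ((2 * t)%:E <= mu (ball x r))%E ->
  superlevel f sigma x ->
  (((sigma - tau) `^ alpha / 2)%:E <= (mu (ball x r))^-1 *
   \int[mu]_(y in ball x r) (`|f x - f y| `^ alpha)%:E)%E.
Proof.
move=> alpha0 mf tau0 ts r0 ft tr fx.
have [m m0 rm] := mu_ball_EFin doubling_mu x r r0.
pose G := ball x r `\` superlevel f tau.
have mB := measurable_mball doubling_mu x r.
have mL := measurable_superlevel f tau mf.
have mG : measurable G by exact: measurableD.
have Gm : ((m / 2)%:E <= mu G)%E.
  have mE : (m%:E = mu G + mu (ball x r `&` superlevel f tau))%E.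
    by rewrite -rm; exact: measureDI.
  have : (mu (ball x r `&` superlevel f tau) <= t%:E)%E.
    by apply: le_trans ft; rewrite le_measure ?inE//; exact: measurableI.
  have : (mu G <= m%:E)%E by rewrite mE leeDl.
  move: tr mE; rewrite rm lee_fin.
  have := measure_ge0 mu G; have := measure_ge0 mu (ball x r `&` superlevel f tau).
  case: (mu G) (mu (ball x r `&` superlevel f tau)) => [g||] [l||]//=.
  by rewrite !lee_fin => _ _ tm /eqP; rewrite -?EFinD eqe => /eqP mE _ lt; lra.
have H : (((sigma - tau) `^ alpha * (m / 2))%:E <=
    \int[mu]_(y in ball x r) (`|f x - f y| `^ alpha)%:E)%E.
  apply: (@le_trans _ _ (((sigma - tau) `^ alpha)%:E * mu G)%E).
    by rewrite EFinM lee_wpmul2l// lee_fin powR_ge0.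
  apply: mul_measure_le_integral => //; first by move=> y [].
  - exact: powR_ge0.
  - move=> y [_ /negP]; rewrite -leNgt => fy.
    rewrite lee_fin ge0_ler_powR ?nnegrE ?subr_ge0 ?(ltW ts)// ?(ltW alpha0)//.
    apply: le_trans (lerB_dist _ _); apply: lerB => //; exact: ltW.
rewrite rm inver gt_eqF//; apply: le_trans (lee_wpmul2l _ H).
  by rewrite -EFinM lee_fin le_eqVlt; apply/orP; left; apply/eqP; field;
    rewrite gt_eqF.
by rewrite lee_fin invr_ge0 ltW.
Qed.

(** By [average_ge] the function nabla^alpha dominates (sigma - tau)^alpha / 2
on the superlevel set of [sigma], hence on a part of that set that has finite
measure above [t'], whose indicator has norm at least phi(t'). No condition on
nabla has to be checked: if it is not in X the right side is +oo. *)
Lemma modulus_ge (f : T -> R) (alpha sigma tau t t' r : R) :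
  0 < alpha -> measurable_fun setT f -> 0 <= tau -> tau < sigma -> 0 < r ->
  0 < t' -> (mu (superlevel f tau) <= t%:E)%E -> (t'%:E < mu (superlevel f
    sigma))%E ->
  (forall x, (2 * t)%:E <= mu (ball x r))%E ->
  ((2^-1 `^ alpha^-1 * (sigma - tau) * power_fundamental X alpha t')%:E <=
   modulus X alpha f r)%E.
Proof.
move=> alpha0 mf tau0 ts r0 t'0 ft ft' tr.
have ai0 : alpha^-1 != 0 by rewrite gt_eqF// invr_gt0.
rewrite /modulus /power_norm /ri_enorm; case: asboolP; last first.
  by rewrite poweRyr// leey.
pose g (x : T) := (`|nabla mu alpha r f x| `^ alpha)%E.
change (fun x => `|nabla mu alpha r f x| `^ alpha)%E with g => -[gfin cg].
have gE x : g x = ((mu (ball x r))^-1 *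
   \int[mu]_(y in ball x r) (`|f x - f y| `^ alpha)%:E)%E.
  rewrite /g /nabla gee0_abs ?poweR_ge0// -poweRrM mulVf ?gt_eqF// poweRe1//.
  rewrite mule_ge0 ?inve_ge0//; apply: integral_ge0 => y _.
  by rewrite lee_fin powR_ge0.
have [n nt'] : exists n : nat, (t'%:E < mu (superlevel f sigma `&` ball point
  n.+1%:R))%E.
  apply/not_existsP => H; move: ft'; apply/negP; rewrite -leNgt.
  apply: (le_mu_exhaust doubling_mu); first exact: measurable_superlevel.
  by move=> n; rewrite leNgt; apply/negP/H.
set A := _ `&` _ in nt'.
have mA : measurable A.
  apply: measurableI; first exact: measurable_superlevel.
  exact: (measurable_mball doubling_mu).
have [m m0 mm] := mu_ball_EFin doubling_mu point _ (ltr0Sn R n).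
have Aoo : (mu A < +oo)%E.
  apply: (@le_lt_trans _ _ m%:E); last exact: ltry.
  rewrite -mm le_measure ?inE//; last exact: subIsetr.
  exact: (measurable_mball doubling_mu).
have muA : mu A = (fine (mu A))%:E by rewrite fineK// ge0_fin_numE.
pose c := (sigma - tau) `^ alpha / 2.
have c0 : 0 <= c by rewrite divr_ge0// powR_ge0.
have cA := ri_indic X mA Aoo.
have [||| _ le] := @ri_lattice _ _ _ _ X _ (fun x => c * \1_A x) cg.
- by apply: measurable_funM => //; exact: measurable_indic.
- by move=> x; rewrite mulr_ge0.
- apply: filterS gfin => x gx; rewrite /= -lee_fin fineK//.
  rewrite indicE; have [|_] := boolP (x \in A); last first.
    by rewrite mulr0 gE -(gE x) /g poweR_ge0.
  by rewrite inE mulr1 => -[fx _]; rewrite gE; exact: average_ge ft _ _.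
have {le} : (c * fundamental X t') `^ alpha^-1 <= (ri_norm X (fine \o g)) `^
  alpha^-1.
  have ai : 0 <= alpha^-1 by rewrite invr_ge0 ltW.
  have cphi : 0 <= c * fundamental X t' by apply: mulr_ge0 => //; exact:
    fundamental_ge0.
  rewrite ge0_ler_powR ?nnegrE ?ri_norm_ge0//.
  apply: le_trans le; rewrite (ri_normZ c cA) ger0_norm// ler_wpM2l//.
  rewrite -(@fundamentalE _ _ _ _ X A (fine (mu A)))//.
  apply: fundamental_nondecreasing => //.
  by rewrite -lee_fin -muA ltW.
rewrite -lee_fin => H; apply: le_trans H.
rewrite lee_fin powRM ?fundamental_ge0// /c powRM ?powR_ge0// -powRrM.
rewrite mulfV ?gt_eqF// powRr1 ?subr_ge0 ?(ltW ts)//.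
by rewrite (mulrC (sigma - tau)).
Qed.

End modulus_lower_bound.

(** * Decreasing rearrangements *)

Section rearrangement_theory.
Context {R : realType} {d : measure_display} {T : metricMeasurableType R d}.
Context {mu : {measure set T -> \bar R}}.
Local Open Scope ereal_scope.
Implicit Types (f : T -> R) (t sigma : R).

Lemma superlevelS f sigma tau : (sigma <= tau)%R ->
  superlevel f tau `<=` superlevel f sigma.
Proof. by move=> st x; exact: le_lt_trans. Qed.

Lemma rearrangement_ge0 f t : 0 <= rearrangement mu f t.
Proof. by apply: le_ereal_inf_tmp => _ [s [s0 _] <-]; rewrite lee_fin. Qed.

Lemma rearrangement_le f t sigma : (0 <= sigma)%R ->
  mu (superlevel f sigma) <= t%:E -> rearrangement mu f t <= sigma%:E.
Proof. by move=> s0 st; apply: ereal_inf_lbound; exists sigma. Qed.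

Lemma rearrangement_gt f t sigma : (0 <= sigma)%R ->
  sigma%:E < rearrangement mu f t -> t%:E < mu (superlevel f sigma).
Proof.
move=> s0; rewrite ltNge => H; rewrite ltNge; apply: contra H.
exact: rearrangement_le.
Qed.

Lemma mu_superlevel_le f t sigma : measurable_fun setT f ->
  rearrangement mu f t < sigma%:E -> mu (superlevel f sigma) <= t%:E.
Proof.
move=> mf /ereal_inf_lt [_ [tau [tau0 ft] <-]]; rewrite lte_fin => ts.
apply: le_trans ft; rewrite le_measure ?inE//; try exact: measurable_superlevel.
by apply: superlevelS; exact: ltW.
Qed.

Lemma rearrangement_nonincreasing f t t' : (t <= t')%R ->
  rearrangement mu f t' <= rearrangement mu f t.
Proof.
move=> tt'; apply: le_ereal_inf => _ [s [s0 st] <-]; exists s => //; split => //.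
by apply: le_trans st _; rewrite lee_fin.
Qed.

Hypothesis mu_infinite : mu [set: T] = +oo.

(** Markov's inequality, with the bound arranged so that n0 = 0 is allowed. *)
Lemma markov_superlevel f (alpha lam n0 t : R) : (0 < alpha)%R -> (0 < t)%R ->
  measurable_fun setT f -> 'N[mu]_(alpha%:E)[EFin \o f] = n0%:E ->
  (0 < lam)%R -> (n0 <= t `^ alpha^-1 * lam)%R ->
  mu (superlevel f lam) <= t%:E.
Proof.
move=> alpha0 t0 mf fn lam0 nlam.
have n0_ge0 : (0 <= n0)%R by rewrite -lee_fin -fn Lnorm_ge0.
have I : \int[mu]_x (`|(EFin \o f) x| `^ alpha) = (n0 `^ alpha)%:E.
  rewrite -poweR_EFin -fn unlock -poweRrM mulVf ?gt_eqF// poweRe1//.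
  by apply: integral_ge0 => x _; exact: poweR_ge0.
have mS := measurable_superlevel f lam mf.
have H : (lam `^ alpha)%:E * mu (superlevel f lam) <= (n0 `^ alpha)%:E.
  rewrite -I; apply: mul_measure_le_integral => //.
  - exact: powR_ge0.
  - by move=> x _; exact: poweR_ge0.
  - move=> x fx; rewrite /= lee_fin ge0_ler_powR ?nnegrE ?(ltW lam0)//.
      exact: ltW.
    exact: ltW.
move: H; rewrite muleC -lee_pdivlMr ?powR_gt0// => /le_trans; apply.
rewrite lee_fin ler_pdivrMr ?powR_gt0//.
rewrite -[X in (X * _)%R](@powRr1 _ t) ?(ltW t0)// -(mulVf (lt0r_neq0 alpha0))
  powRrM.
rewrite -powRM ?powR_ge0 ?(ltW lam0)//.
rewrite ge0_ler_powR ?nnegrE ?(ltW alpha0)// mulr_ge0 ?powR_ge0//.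
exact: ltW.
Qed.

(** If f = f0 + f1, then outside a null set |f| > |f1|_oo + lam implies
|f0| > lam, and lam is chosen by Markov's inequality. The extra e keeps lam
positive when f0 = 0. *)
Lemma rearrangement_le_sum_norm f (alpha t : R) : (0 < alpha)%R -> (0 < t)%R ->
  rearrangement mu f t <= (1 + t `^ (- alpha^-1))%:E * sum_norm mu alpha f.
Proof.
move=> alpha0 t0; set c := (1 + _)%R.
have c0 : (0 < c)%R by rewrite ltr_wpDr// powR_ge0.
rewrite -lee_pdivrMl//; apply: le_ereal_inf_tmp => _ [f0 [f1 [mf0 mf1 ff ->]]].
rewrite lee_pdivrMl//.
have := Lnorm_ge0 mu alpha%:E (EFin \o f0).
have := Lnorm_ge0 mu +oo (EFin \o f1).
case E0 : 'N[mu]_(alpha%:E)[EFin \o f0] => [n0||]//; last first.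
  by case: 'N[mu]_(+oo)[_] => //= *; rewrite ?addye// gt0_muley ?leey// lte_fin.
case E1 : 'N[mu]_(+oo)[EFin \o f1] => [n1||]// => [|*]; last first.
  by rewrite addey// gt0_muley ?leey ?lte_fin.
rewrite !lee_fin => n10 n00.
have f1n : \forall x \ae mu, `|(EFin \o f1) x| <= n1%:E.
  by apply/ess_supP; rewrite -E1 unlock mu_infinite lt0y.
have key (e : R) : (0 < e)%R ->
    rearrangement mu f t <= (n1 + t `^ (- alpha^-1) * (n0 + e))%:E.
  move=> e0; have l0 : (0 < t `^ (- alpha^-1) * (n0 + e))%R.
    by rewrite mulr_gt0 ?powR_gt0// ltr_wpDl.
  apply: rearrangement_le; first by rewrite addr_ge0// ltW.
  have : mu (superlevel f0 (t `^ (- alpha^-1) * (n0 + e))) <= t%:E.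
    apply: (markov_superlevel f0 alpha _ n0) => //.
    rewrite mulrA -powRD ?(gt_eqF t0) ?implybT// subrr powRr0 mul1r.
    by rewrite lerDl ltW.
  apply: le_trans; case: f1n => N [mN N0 f1N].
  have mS := measurable_superlevel f0 (t `^ (- alpha^-1) * (n0 + e)) mf0.
  apply: (@le_trans _ _ (mu (superlevel f0 (t `^ (- alpha^-1) * (n0 + e)) `|` N))).
    rewrite le_measure ?inE//; first by
      apply: measurable_superlevel; rewrite ff; exact: measurable_funD.
      exact: measurableU.
    move=> x /= fx; have [|xN] := pselect (N x); first by right.
    left; rewrite /superlevel/= ltNge; apply/negP => f0x; apply: xN.
    apply: f1N => /=; rewrite lee_fin => f1x; move: fx; rewrite /superlevel/= ff/=.
    apply/negP; rewrite -leNgt; apply: le_trans (ler_normD _ _) _.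
    by rewrite addrC lerD.
  by rewrite -[leRHS]adde0 -N0 measureU2.
apply: (@le_trans _ _ (n1 + t `^ (- alpha^-1) * n0)%:E); last first.
  rewrite -EFinD -EFinM lee_fin /c; have := powR_ge0 t (- alpha^-1); nra.
apply/lee_addgt0Pr => e e0; have tp := @powR_gt0 _ t (- alpha^-1) t0.
apply: le_trans (key (e / t `^ (- alpha^-1))%R _) _; first by rewrite divr_gt0.
rewrite -EFinD lee_fin le_eqVlt; apply/orP; left; apply/eqP.
by field; rewrite gt_eqF.
Qed.

Lemma Lnorm_oo_le_rearrangement f (M : R) : measurable_fun setT f ->
  (forall t, (0 < t)%R -> rearrangement mu f t <= M%:E) ->
  'N[mu]_(+oo)[EFin \o f] <= M%:E.
Proof.
move=> mf fM; apply/lee_addgt0Pr => e e0; rewrite unlock mu_infinite lt0y.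
apply/ess_supP; exists (superlevel f (M + e)); split.
- exact: measurable_superlevel.
- apply/eqP; rewrite eq_le measure_ge0 andbT; apply/lee_addgt0Pr => t t0.
  rewrite add0e; apply: mu_superlevel_le => //; apply: le_lt_trans (fM t t0) _.
  by rewrite lte_fin ltrDl.
- move=> x /= /negP; rewrite -ltNge -EFinD lte_fin; exact.
Qed.

End rearrangement_theory.

(** * Derivatives of tail integrals *)

Definition tail_integral {R : realType} (w : R -> R) (t : R) : \bar R :=
  (\int[lebesgue_measure]_(z in `[t, 1%R]) (w z)%:E)%E.

Section tail_integral_theory.
Context {R : realType}.
Variable w : R -> R.
Hypothesis w0 : forall z : R, 0 < z -> 0 <= w z.
Hypothesis mw : measurable_fun (`]0, 1]%classic : set R) w.
Hypothesis w_bounded : forall t : R, 0 < t -> exists L : R, forall z : R, t <=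
  z <= 1 -> w z <= L.

Local Notation m := (tail_integral w).

Let w_cell_ge0 (D : set R) t : 0 < t -> D `<=` `[t, 1] -> forall z, D z -> (0
  <= (w z)%:E)%E.
Proof.
move=> t0 Dt z /Dt/=; rewrite in_itv/= => /andP[tz _].
by rewrite lee_fin w0// (lt_le_trans t0).
Qed.

Let m_bound (x y L : R) (bx by' : bool) : 0 < x -> x <= y -> 0 <= L ->
  (forall z, x <= z <= y -> w z <= L) ->
  (\int[lebesgue_measure]_(z in [set` Interval (BSide bx x) (BSide by' y)])
     (w z)%:E <= (L * (y - x))%:E)%E.
Proof.
move=> x0 xy L0 wL; set D := [set` _].
have Dxy z : D z -> x <= z <= y.
  by rewrite /D/= => /itvP h; case: bx by' @D h => -[] D h; rewrite ?h//=; 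
    rewrite ?(ltW, h).
apply: (@le_trans _ _ (\int[lebesgue_measure]_(z in D) (cst L%:E z))%E).
  apply: ge0_le_integral_nonmeas => z Dz; rewrite /= lee_fin; have := Dxy _ Dz
    => zxy.
    by rewrite w0// (lt_le_trans x0)//; case/andP: zxy.
  exact: wL.
rewrite integral_cst; last exact: measurable_itv.
rewrite EFinM lee_wpmul2l ?lee_fin//.
rewrite /D/= lebesgue_measure_itv/= lte_fin.
by case: ifPn => // _; rewrite lee_fin subr_ge0.
Qed.

Lemma tail_integral_fin t : 0 < t -> m t \is a fin_num.
Proof.
move=> t0; rewrite ge0_fin_numE; last first.
  by apply: integral_ge0 => z; exact: (@w_cell_ge0 _ t).
have [t1|t1] := leP t 1; last first.
  by rewrite /tail_integral set_itv_ge ?integral_set0 ?ltry// bnd_simp -ltNge.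
have [L wL] := w_bounded t t0.
apply: le_lt_trans (ltry (Num.max L 0 * (1 - t))).
apply: m_bound => //; first by rewrite le_max lexx orbT.
by move=> z /wL; rewrite le_max => ->.
Qed.

Let m_diff x y L : 0 < x -> x <= y -> y < 1 -> 0 <= L ->
  (forall z, x <= z <= y -> w z <= L) ->
  `|fine (m y) - fine (m x)| <= L * (y - x).
Proof.
move=> x0 xy y1 L0 wL.
have split : m x = (\int[lebesgue_measure]_(z in `[x, y[) (w z)%:E + m y)%E.
  have xyE : `[x, 1]%classic = `[x, y[ `|` `[y, 1].
    apply/seteqP; split => z /=; rewrite !in_itv/=.
      by move=> /andP[-> ->]; case: (ltP z y) => zy; [left|right].
    move=> [/andP[-> zy]|/andP[yz ->]]/=.
      by rewrite ltW// (lt_trans zy).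
    by rewrite andbT (le_trans xy).
  rewrite /tail_integral xyE ge0_integral_setU//.
  - rewrite -xyE; apply/measurable_EFinP; apply: measurable_funS mw => //.
    by apply: subset_itvr; rewrite bnd_simp.
  - by rewrite -xyE; exact: (@w_cell_ge0 _ x).
  - apply/disj_setPS => z [] /=; rewrite !in_itv/= => /andP[_ zy] /andP[yz _].
    by move: zy; rewrite ltNge yz.
have mx := tail_integral_fin x x0.
have my := tail_integral_fin y (lt_le_trans x0 xy).
set I := integral _ _ _ in split.
have I0 : (0 <= I)%E.
  apply: integral_ge0 => z /=; rewrite in_itv/= => /andP[xz _].
  by rewrite lee_fin w0// (lt_le_trans x0).
have IL : (I <= (L * (y - x))%:E)%E by exact: m_bound.
move: split I0 IL mx; rewrite -(fineK my); case: (m x) I => [a||] [i||]//=.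
rewrite !lee_fin => -[->] i0 iL _.
by rewrite opprD addrA addrAC subrr add0r normrN ger0_norm.
Qed.

(** Only an upper bound for |m'| is needed, and it follows from a local
Lipschitz bound whether or not m is differentiable: a limit that does not exist
takes the default value 0. *)
Lemma derive1_tail_integral_le t L : 0 < t -> t < 1 -> 0 <= L ->
  (forall z, t / 2 <= z <= 2 * t -> z <= 1 -> w z <= L) ->
  `|derive1 (fine \o m) t| <= L.
Proof.
move=> t0 t1 L0 wL; rewrite /derive1.
set F := (X in lim X).
have [cF|/dvgP ->] := pselect (cvg F); last by rewrite (_ : point = 0)// normr0.
have : (fun h => `|h^-1 *: ((fine \o m) (h + t) - (fine \o m) t)|) @ 0^' -->
  `|lim F|.
  by apply: cvg_norm; exact: cF.
move=> /cvgr_to_le; apply.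
have e0 : 0 < Num.min (t / 2) (1 - t).
  by rewrite lt_min divr_gt0//= subr_gt0.
apply/nbhs_ballP; exists (Num.min (t / 2) (1 - t)) => // h.
rewrite /ball/= sub0r normrN lt_min => /andP[h1 h2] hN0.
have [h1a h1b] : - (t / 2) < h /\ h < t / 2 by apply/andP; rewrite -ltr_norml.
have [_ h2b] : - (1 - t) < h /\ h < 1 - t by apply/andP; rewrite -ltr_norml.
rewrite normrM normfV ler_pdivrMl ?normr_gt0// mulrC.
have [h0|h0] := leP 0 h.
  have := @m_diff t (h + t) L t0.
  rewrite lerDr [`|h|]ger0_norm// => /(_ h0); rewrite (_ : h + t - t = h); last
    by ring.
  apply => //; first by lra.
  by move=> z /andP[tz zt]; apply: wL; lra.
have := @m_diff (h + t) t L.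
rewrite distrC [`|h|]ltr0_norm// (_ : t - (h + t) = - h); last by ring.
apply => //; try lra.
by move=> z /andP[tz zt]; apply: wL; lra.
Qed.

End tail_integral_theory.

(** * The criterion m on geometric cells *)

Definition embedding_weight {R : realType} (psi : R -> R) (theta z : R) : R :=
  z `^ theta / psi z.

Definition embedding_density {R : realType} (psi : R -> R)
    (theta gam z : R) : R := embedding_weight psi theta z `^ gam / z.

(** The value of [embedding_weight] at [scale beta lam k.+1], up to the constant
factor in [cell_weightE]. *)
Definition cell_weight {R : realType} (psi : R -> R) (theta beta lam : R)
    (k : nat) : R := (lam `^ theta) ^+ k / psi (scale beta lam k.+1).

Section criterion.
Context {R : realType}.
Variables (psi : R -> R) (a theta beta lam : R).
Hypotheses (psi0 : forall z, 0 < z -> 0 < psi z)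
  (psi_nd : forall z1 z2, 0 < z1 -> z1 <= z2 -> psi z1 <= psi z2)
  (psi_growth : forall c z1 z2, 0 < z1 -> z1 <= z2 -> z2 <= c * z1 ->
     psi z2 <= (2 * c) `^ a * psi z1).
Hypotheses (theta0 : 0 < theta) (beta0 : 0 < beta) (beta1 : beta < 1)
  (lam0 : 0 < lam) (lam1 : lam < 1).

Local Notation t_ := (scale beta lam).
Local Notation h := (embedding_weight psi theta).
Local Notation hk := (cell_weight psi theta beta lam).
Let rho : R := lam `^ theta.

Let t_gt0 k : 0 < t_ k. Proof. exact: scale_gt0. Qed.

Let rho_gt0 : 0 < rho. Proof. exact: powR_gt0. Qed.

Let t_powR k : t_ k `^ theta = beta `^ theta * rho ^+ k.
Proof.
have lamk : 0 <= lam ^+ k by rewrite exprn_ge0// ltW.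
rewrite powRM ?(ltW beta0)// -(@powR_mulrn _ lam k (ltW lam0)) powRAC.
by rewrite (@powR_mulrn _ _ k (powR_ge0 lam theta)).
Qed.

Lemma cell_weight_gt0 k : 0 < hk k.
Proof. by rewrite divr_gt0 ?exprn_gt0// psi0. Qed.

Let psi_lam k : psi (t_ k) <= (2 / lam) `^ a * psi (t_ k.+1).
Proof.
apply: psi_growth => //; first by apply: scale_le => //; exact: leqnSn.
by rewrite /scale exprS mulrCA [lam^-1 * _]mulrA mulVf ?mul1r// gt_eqF.
Qed.

Lemma cell_weightS k : hk k.+1 <= rho * (2 / lam) `^ a * hk k.
Proof.
have l2 : 0 < (2 / lam) `^ a by rewrite powR_gt0// divr_gt0.
rewrite /cell_weight exprS -!mulrA ler_pM2l// mulrCA ler_pM2l ?exprn_gt0//.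
by rewrite ler_pdivlMr ?psi0// mulrC ler_pdivrMr ?psi0.
Qed.

Lemma cell_weightE k : h (t_ k.+1) = beta `^ theta * rho * hk k.
Proof. by rewrite /embedding_weight t_powR exprS /cell_weight; ring. Qed.

(** psi(z) z^(-theta) is the function v of the weighted embedding, the inverse
of [embedding_weight]; on the cell scale it is comparable with 1 / hk. *)
Lemma cell_weight_dual k :
  hk k * (psi (t_ k) * t_ k `^ (- theta)) <= beta `^ (- theta) * (2 / lam) `^ a.
Proof.
have bt : 0 < beta `^ theta by exact: powR_gt0.
rewrite !powRN t_powR /cell_weight.
rewrite [leLHS](_ : _ = (beta `^ theta)^-1 * (psi (t_ k) / psi (t_ k.+1))).
  by rewrite ler_pM2l ?invr_gt0// ler_pdivrMr ?psi0// psi_lam.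
by field; rewrite !gt_eqF ?exprn_gt0 ?psi0.
Qed.

Let kappa := beta `^ theta * rho / (2 / lam) `^ a.

Let kappa_gt0 : 0 < kappa.
Proof. by rewrite !mulr_gt0 ?powR_gt0// invr_gt0 powR_gt0// divr_gt0. Qed.

Let h_cell_ge k z : t_ k.+1 <= z < t_ k -> kappa * hk k <= h z.
Proof.
move=> /andP[tz zt]; have z0 : 0 < z by exact: lt_le_trans tz.
have l2 : 0 < (2 / lam) `^ a by rewrite powR_gt0// divr_gt0.
apply: (@le_trans _ _ (t_ k.+1 `^ theta / psi (t_ k))); last first.
  rewrite /embedding_weight ler_pM ?powR_ge0 ?invr_ge0 ?(ltW (psi0 _ _))//.
    by rewrite ge0_ler_powR ?nnegrE ?(ltW theta0) ?(ltW z0)// ltW.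
  by rewrite lef_pV2 ?posrE ?psi0// psi_nd// ltW.
rewrite t_powR exprS /kappa /cell_weight ler_pdivlMr ?psi0//.
rewrite [leLHS](_ : _ = beta `^ theta * (rho * rho ^+ k) *
  (psi (t_ k) / ((2 / lam) `^ a * psi (t_ k.+1)))); last first.
  by field; rewrite !gt_eqF ?psi0.
rewrite ler_piMr ?mulr_ge0 ?powR_ge0 ?exprn_ge0 ?(ltW rho_gt0)//.
by rewrite ler_pdivrMr ?mul1r ?psi_lam// mulr_gt0// psi0.
Qed.

Section exponent.
Variable gam : R.
Hypothesis gam0 : 0 < gam.

Local Notation w := (embedding_density psi theta gam).
Local Notation m := (tail_integral w).

Let w_ge0 z : 0 <= z -> 0 <= w z.
Proof. by move=> z0; rewrite divr_ge0// powR_ge0. Qed.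

(** psi is monotone only on the positive half-line, so it is extended by 0 to a
function that is monotone everywhere. *)
Lemma measurable_weight : measurable_fun (`]0, 1]%classic : set R) w.
Proof.
pose psi' z := if 0 < z then psi z else 0.
have mpsi' : measurable_fun setT psi'.
  apply: nondecreasing_measurable => // x y xy; rewrite /psi'.
  case: ifPn => [x0|_]; first by rewrite (lt_le_trans x0 xy) psi_nd.
  by case: ifPn => // y0; rewrite ltW// psi0.
apply: (eq_measurable_fun (fun z : R =>
    (z `^ theta * psi' z `^ (-1)) `^ gam * z `^ (-1))).
  move=> z; rewrite inE/= in_itv/= => /andP[z0 _].
  by rewrite /embedding_density /embedding_weight /psi' z0 !powR_inv1// ltW// psi0.
apply: measurable_funM; last first.
  by apply: measurable_funTS; exact: measurable_powR.
apply: (@measurableT_comp _ _ _ _ _ _ (@powR R ^~ gam)).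
  exact: measurable_powR.
apply: measurable_funM; apply: measurable_funTS.
  exact: measurable_powR.
by apply: (@measurableT_comp _ _ _ _ _ _ (@powR R ^~ (-1))) => //; exact:
  measurable_powR.
Qed.

Lemma weight_bounded t : 0 < t -> exists L : R, forall z : R, t <= z <= 1 -> w
  z <= L.
Proof.
move=> t0; exists ((1 / psi t) `^ gam / t) => z /andP[tz z1].
have z0 : 0 < z by exact: lt_le_trans tz.
rewrite /embedding_density ler_pM ?powR_ge0 ?invr_ge0 ?(ltW z0)//; last first.
  by rewrite lef_pV2.
have hz0 : 0 <= h z by rewrite divr_ge0 ?powR_ge0// ltW// psi0.
rewrite ge0_ler_powR ?nnegrE ?(ltW gam0)// ?divr_ge0 ?(ltW (psi0 _ t0))//.
rewrite /embedding_weight ler_pM ?powR_ge0 ?invr_ge0 ?(ltW (psi0 _ z0))//.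
  have -> : 1 = 1 `^ theta :> R by rewrite powR1.
  rewrite ge0_ler_powR ?nnegrE ?(ltW theta0)//.
  exact: ltW.
by rewrite lef_pV2 ?posrE ?psi0// psi_nd.
Qed.

Definition tail_constant : R := kappa `^ gam * (1 - lam).

Lemma tail_constant_gt0 : 0 < tail_constant.
Proof. by rewrite mulr_gt0 ?powR_gt0// subr_gt0. Qed.

(** The density is at least a multiple of hk k^gam / t_ k on the cell
[t_ k.+1, t_ k), whose length is a multiple of t_ k. *)
Lemma sum_cell_weight_le (t : R) N : 0 <= t -> t <= t_ N ->
  ((tail_constant * \sum_(k < N) hk k `^ gam)%:E <= m t)%E.
Proof.
move=> t0 tN.
have := @sum_le_integral _ _ _ (@lebesgue_measure R) `[t, 1%R]
  (fun k => `[t_ k.+1, t_ k[%classic)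
  (fun k => kappa `^ gam * hk k `^ gam / t_ k) (fun z => (w z)%:E) N.
have -> : (\sum_(k < N) (kappa `^ gam * hk k `^ gam / t_ k)%:E *
    lebesgue_measure (`[t_ k.+1, t_ k[%classic : set R))%E =
    (tail_constant * \sum_(k < N) hk k `^ gam)%:E.
  rewrite mulr_sumr -sumEFin; apply: eq_bigr => k _.
  rewrite lebesgue_measure_scale// -EFinM; congr EFin.
  rewrite -/(t_ k) /tail_constant; field; rewrite gt_eqF//; exact: t_gt0.
apply.
- exact: measurable_itv.
- by move=> k; exact: measurable_itv.
- move=> k kN z /=; rewrite !in_itv/= => /andP[kz zk].
  apply/andP; split.
    by rewrite (le_trans tN)// (le_trans _ kz)// scale_le.
  rewrite (le_trans (ltW zk))// (le_trans _ (ltW beta1))//.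
  by rewrite /scale ler_piMr ?(ltW beta0)// exprn_ile1// ltW.
- exact: scale_trivIset.
- by move=> k; rewrite !mulr_ge0 ?powR_ge0// invr_ge0 ltW.
- by move=> z /=; rewrite in_itv/= => /andP[tz _]; rewrite lee_fin w_ge0//
  (le_trans t0).
- move=> k z _ /=; rewrite in_itv/= => kz; rewrite lee_fin /w.
  have z0 : 0 < z by case/andP: kz => kz _; exact: lt_le_trans kz.
  have hk0 := ltW (cell_weight_gt0 k).
  rewrite ler_pM ?mulr_ge0 ?powR_ge0 ?invr_ge0 ?(ltW (t_gt0 _))//.
    rewrite -powRM ?(ltW kappa_gt0)//.
    have khk0 := mulr_ge0 (ltW kappa_gt0) hk0.
    have hz0 : 0 <= h z by rewrite divr_ge0 ?powR_ge0// ltW// psi0.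
    by rewrite ge0_ler_powR ?nnegrE ?(ltW gam0)// h_cell_ge.
  by rewrite lef_pV2 ?posrE//; case/andP: kz => _ /ltW.
Qed.

(** For t close to t_ k the integral m(t) does not see the k-th cell. The k-th
term is therefore bounded by the previous one with [cell_weightS], or by a
constant if k = 0. *)
Lemma sum_cell_weight_le1 : exists2 C : R, 0 < C & forall (t : R) k,
  0 < t -> t <= t_ k ->
  ((1 + \sum_(j < k.+1) hk j `^ gam)%:E <= C%:E * (1 + m t))%E.
Proof.
pose H := (rho * (2 / lam) `^ a) `^ gam.
have c0 := tail_constant_gt0.
have H0 : 0 <= H by exact: powR_ge0.
have h00 : 0 <= hk 0 `^ gam by exact: powR_ge0.
exists ((1 + hk 0 `^ gam + H) * (1 + tail_constant^-1)).
  apply: mulr_gt0; last by rewrite ltr_wpDr// invr_ge0 ltW.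
  by rewrite !ltr_wpDr.
move=> t k t0 tk.
have := sum_cell_weight_le t k (ltW t0) tk.
have : (m t \is a fin_num).
  apply: tail_integral_fin => //; first by move=> z /ltW/w_ge0.
  exact: weight_bounded.
case: (m t) => [mt||]// _; rewrite !lee_fin.
set S := \sum_(j < k) _ => Smt.
have S0 : 0 <= S by apply: sumr_ge0 => *; exact: powR_ge0.
have St : S <= tail_constant^-1 * mt by rewrite -ler_pdivrMl ?invr_gt0// invrK.
have last : hk k `^ gam <= hk 0 `^ gam + H * S.
  case: k {tk Smt St S0} @S => [|k] S; first by rewrite /S big_ord0 mulr0 addr0.
  apply: (@le_trans _ _ (H * hk k `^ gam)).
    have hk0 j := ltW (cell_weight_gt0 j).
    have rl0 : 0 <= rho * (2 / lam) `^ a by rewrite mulr_ge0// ?powR_ge0// ltW.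
    rewrite /H -powRM// ge0_ler_powR ?nnegrE ?(ltW gam0)//; first exact: mulr_ge0.
    exact: cell_weightS.
  rewrite ler_wpDl// ler_wpM2l// /S big_ord_recr/= lerDr.
  by apply: sumr_ge0 => *; exact: powR_ge0.
rewrite big_ord_recr/= -/S.
apply: (@le_trans _ _ ((1 + hk 0 `^ gam + H) * (1 + S))); first by nra.
have A0 : 0 <= 1 + hk 0 `^ gam + H by rewrite !addr_ge0.
rewrite -mulrA ler_wpM2l//.
have mt0 : 0 <= mt.
  by apply: le_trans (le_trans Smt (lexx _)); rewrite mulr_ge0// ltW.
have : 0 <= tail_constant^-1 by rewrite invr_ge0 ltW.
by set c := _^-1 in St *; nra.
Qed.

(** The Lipschitz bound is taken on [t / 2, 2 t], which leaves the cell by a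
bounded factor, so the density is still of the order of hk k^gam / t_ k. *)
Lemma derive1_tail_cell_le : exists2 C : R, 0 < C & forall (t : R) k,
  t_ k.+1 <= t < t_ k ->
  `|derive1 (fine \o m) t| <= C * (hk k `^ gam / t_ k).
Proof.
pose k' := 2 `^ theta * beta `^ theta * (2 * 2) `^ a.
exists (k' `^ gam * (2 / lam)).
  by rewrite mulr_gt0 ?powR_gt0 ?divr_gt0// !mulr_gt0 ?powR_gt0// mulr_gt0.
move=> t k /andP[kt tk]; have t0 : 0 < t by exact: lt_le_trans kt.
have t1 : t < 1.
  apply: lt_trans tk _; apply: le_lt_trans beta1.
  by rewrite /scale ler_piMr ?(ltW beta0)// exprn_ile1// ltW.
have k'0 : 0 <= k' by rewrite !mulr_ge0 ?powR_ge0.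
have hk0 := ltW (cell_weight_gt0 k).
apply: derive1_tail_integral_le => //.
- by move=> z /ltW/w_ge0.
- exact: measurable_weight.
- exact: weight_bounded.
- by rewrite !mulr_ge0 ?powR_ge0 ?invr_ge0 ?(ltW lam0)// ltW.
move=> z /andP[tz zt] _.
have z0 : 0 < z by apply: lt_le_trans tz; rewrite divr_gt0.
rewrite /embedding_density mulrACA ler_pM ?powR_ge0 ?invr_ge0 ?(ltW z0)//; last
  first.
  have -> : 2 / lam / t_ k = (t_ k.+1 / 2)^-1.
    by rewrite /scale exprS; field; rewrite !gt_eqF// exprn_gt0.
  rewrite lef_pV2 ?posrE ?divr_gt0//; apply: le_trans tz.
  by rewrite ler_pM2r ?invr_gt0.
have hz0 : 0 <= h z by rewrite divr_ge0 ?powR_ge0// ltW// psi0.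
have k'h0 := mulr_ge0 k'0 hk0.
rewrite -powRM// ge0_ler_powR ?nnegrE ?(ltW gam0)//.
have tt0 : 0 < t_ k.+1 / 2 by rewrite divr_gt0.
have pp : psi (t_ k.+1) <= (2 * 2) `^ a * psi (t_ k.+1 / 2).
  apply: psi_growth => //.
    by rewrite ler_pdivrMr// ler_peMr ?(ltW (t_gt0 _))// ler1n.
  by rewrite mulrCA mulfV ?mulr1// pnatr_eq0.
have pz : psi (t_ k.+1 / 2) <= psi z.
  by apply: psi_nd => //; apply: le_trans tz; rewrite ler_pM2r ?invr_gt0.
have p4 : (0 : R) < (2 * 2) `^ a by rewrite powR_gt0// mulr_gt0.
rewrite /embedding_weight ler_pdivrMr ?psi0//.
apply: (@le_trans _ _ (2 `^ theta * (beta `^ theta * rho ^+ k))).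
  have zt2 : z <= 2 * t_ k by apply: le_trans zt _; rewrite ler_pM2l// ltW.
  rewrite -t_powR -powRM ?(ltW (t_gt0 _))//.
  by rewrite ge0_ler_powR ?nnegrE ?(ltW theta0) ?(ltW z0) ?(le_trans (ltW z0) zt2).
rewrite /k' /cell_weight (_ : _ * psi z = 2 `^ theta * (beta `^ theta * rho ^+ k) *
   ((2 * 2) `^ a * psi z / psi (t_ k.+1))); last by field; rewrite gt_eqF// psi0.
rewrite ler_peMr ?mulr_ge0 ?powR_ge0 ?exprn_ge0 ?(ltW rho_gt0)//.
rewrite ler_pdivlMr ?psi0// mul1r (le_trans pp)//.
by rewrite ler_pM2l.
Qed.

Lemma derive1_tail_top_le : exists2 C : R, 0 <= C & forall t : R,
  beta <= t < 1 -> `|derive1 (fine \o m) t| <= C.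
Proof.
have b2 : 0 < beta / 2 by rewrite divr_gt0.
have [L wL] := weight_bounded _ b2.
exists (Num.max L 0) => [|t /andP[bt t1]]; first by rewrite le_max lexx orbT.
apply: derive1_tail_integral_le => //.
- by move=> z /ltW/w_ge0.
- exact: measurable_weight.
- exact: weight_bounded.
- exact: lt_le_trans bt.
- by rewrite le_max lexx orbT.
move=> z /andP[tz _] z1; rewrite le_max wL// z1 andbT.
by apply: le_trans tz; rewrite ler_pM2r ?invr_gt0.
Qed.

End exponent.

End criterion.

(** * From the Besov seminorm to a sequence *)

Section oscillation.
Context {R : realType} {d : measure_display} {T : metricMeasurableType R d}.
Context {mu : {measure set T -> \bar R}} (X : ri_space mu).
Hypotheses (doubling_mu : doubling_space mu) (mu_infinite : mu [set: T] = +oo%E)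
  (concave_phi :
    @convex_function R R^o `]0%R, +oo[ (fun t => (- fundamental X t)%R)).
Variables (alpha s b : R).
Hypotheses (alpha0 : 0 < alpha) (s0 : 0 < s) (b0 : 0 < b)
  (mu_ball1 : forall x : T, (b%:E <= mu (ball x 1))%E).

Local Notation C := (inf (doubling_constant mu)).
Local Notation lam := (C^-1).
Let a := alpha^-1.
Let beta := b / 2.
Let psi := power_fundamental X alpha.
Let theta := s / upper_dimension mu.
Local Notation t_ := (scale beta lam).
Local Notation r_ := (scale 2 2^-1).
Local Notation hk := (cell_weight psi theta beta lam).

Let C1 : 1 < C. Proof. exact: inf_doubling_constant_gt1. Qed.
Let C0 : 0 < C. Proof. exact: lt_trans C1. Qed.
Let lam0 : 0 < lam. Proof. by rewrite invr_gt0. Qed.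
Let beta0 : 0 < beta. Proof. by rewrite divr_gt0. Qed.

Lemma upper_dimension_gt0 : 0 < upper_dimension mu.
Proof. by rewrite divr_gt0// ln_gt0// ltr1n. Qed.

Lemma lam_powR : lam `^ theta = 2 `^ (- s).
Proof.
rewrite /theta -powR_inv1 ?(ltW C0)// -powRrM mulN1r.
have Q0 := upper_dimension_gt0.
have CE : C = 2 `^ upper_dimension mu.
  rewrite /powR pnatr_eq0/= /upper_dimension divfK ?gt_eqF ?ln_gt0 ?ltr1n//.
  by rewrite lnK.
by rewrite [in LHS]CE -powRrM mulrN mulrCA divff ?mulr1// gt_eqF.
Qed.

Lemma doubling_fundamental_gt0 (t : R) : 0 < t -> 0 < fundamental X t.
Proof.
apply: fundamental_gt0 => //; exists (ball point 1).
  exact: (measurable_mball doubling_mu).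
have [m m0 ->] := mu_ball_EFin doubling_mu point 1 ltr01.
by rewrite lte_fin m0 ltry.
Qed.

Lemma power_fundamental_gt0 (t : R) : 0 < t -> 0 < psi t.
Proof. by move=> t0; rewrite powR_gt0// doubling_fundamental_gt0. Qed.

Let ai : 0 <= a. Proof. by rewrite invr_ge0 ltW. Qed.

Lemma power_fundamental_nd (z1 z2 : R) : 0 < z1 -> z1 <= z2 -> psi z1 <= psi z2.
Proof.
move=> z10 z12; rewrite ge0_ler_powR ?nnegrE ?fundamental_ge0//.
exact: fundamental_nondecreasing.
Qed.

Lemma power_fundamental_growth (c z1 z2 : R) : 0 < z1 -> z1 <= z2 ->
  z2 <= c * z1 -> psi z2 <= (2 * c) `^ a * psi z1.
Proof.
move=> z10 z12 z2c.
have c0 : 0 <= c by rewrite -(pmulr_lge0 _ z10) (le_trans _ z2c)// (le_trans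
  (ltW z10)).
rewrite -powRM ?fundamental_ge0 ?mulr_ge0//.
rewrite ge0_ler_powR ?nnegrE ?fundamental_ge0 ?mulr_ge0 ?fundamental_ge0//.
exact: fundamental_growth.
Qed.

Section fixed_function.
Variable f : T -> R.
Hypothesis ff : sum_space mu alpha f.

Definition rearr (t : R) : R := fine (rearrangement mu f t).

Lemma rearrE (t : R) : 0 < t -> rearrangement mu f t = (rearr t)%:E.
Proof.
move=> t0; rewrite fineK// ge0_fin_numE ?rearrangement_ge0//.
apply: le_lt_trans (rearrangement_le_sum_norm mu_infinite f alpha t alpha0 t0) _.
have [_ fs] := ff; apply: lte_mul_pinfty => //.
by rewrite lee_fin addr_ge0// powR_ge0.
Qed.

Lemma rearr_ge0 (t : R) : 0 <= rearr t.
Proof. by rewrite fine_ge0// rearrangement_ge0. Qed.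

Lemma rearr_noninc (t t' : R) : 0 < t -> t <= t' -> rearr t' <= rearr t.
Proof.
move=> t0 tt'; rewrite -lee_fin -!rearrE//; last exact: lt_le_trans tt'.
exact: rearrangement_nonincreasing.
Qed.

Lemma modulus_ge0 (r : R) : (0 <= modulus X alpha f r)%E.
Proof. exact: poweR_ge0. Qed.

(** [modulus_ge] requires levels strictly above F(t_ k) and strictly below
F(t_ k.+1), so it is applied to F(t_ k) + e and F(t_ k.+1) - e. *)
Lemma modulus_ge_jump (k : nat) (r : R) : 2^-1 ^+ k <= r ->
  ((2^-1 `^ a * (rearr (t_ k.+1) - rearr (t_ k)) * psi (t_ k.+1))%:E <=
   modulus X alpha f r)%E.
Proof.
move=> kr; have [mf _] := ff.
have t0 j : 0 < t_ j by rewrite mulr_gt0// exprn_gt0.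
have r0 : 0 < r by apply: lt_le_trans kr; rewrite exprn_gt0// invr_gt0.
have p0 := power_fundamental_gt0 _ (t0 k.+1).
have c0 : 0 < 2^-1 `^ a * psi (t_ k.+1) :> R by rewrite mulr_gt0// powR_gt0//
  invr_gt0.
have key e : 0 < e -> ((2^-1 `^ a *
    (rearr (t_ k.+1) - e - (rearr (t_ k) + e)) * psi (t_ k.+1))%:E <=
    modulus X alpha f r)%E.
  move=> e0; have [D0|D0] := leP (rearr (t_ k.+1) - e) (rearr (t_ k) + e).
    apply: le_trans (modulus_ge0 r); rewrite lee_fin mulrAC.
    by rewrite mulr_ge0_le0 ?(ltW c0)// subr_le0.
  have F0 := rearr_ge0 (t_ k).
  apply: (modulus_ge X doubling_mu concave_phi f alpha _ _ (t_ k) (t_ k.+1)) => //.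
  - by rewrite addr_ge0// ltW.
  - by apply: mu_superlevel_le => //; rewrite rearrE// lte_fin ltrDl.
  - apply: rearrangement_gt; first by rewrite (le_trans _ (ltW D0))//
    addr_ge0// ltW.
    by rewrite rearrE// lte_fin ltrBlDr ltrDl.
  - move=> x; have := mu_ball_ge doubling_mu b x k r b0 (mu_ball1 x) C0 kr.
    by rewrite /scale /beta mulrA mulrCA divff ?mulr1// pnatr_eq0.
case E : (modulus X alpha f r) => [M||]; rewrite ?leey//; last first.
  by have := modulus_ge0 r; rewrite E.
rewrite lee_fin; apply/ler_addgt0Pl => e e0.
set c := 2^-1 `^ a * psi (t_ k.+1) in c0.
have := key (e / (2 * c)); rewrite E lee_fin => /(_ _) H.
have {H} := H (divr_gt0 e0 (mulr_gt0 (ltr0n R 2) c0)).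
rewrite [X in X <= _ -> _](_ : _ = 2^-1 `^ a * (rearr (t_ k.+1) - rearr (t_ k)) *
  psi (t_ k.+1) - e); last first.
  rewrite mulrAC -/c [in RHS]mulrAC -/c; field; rewrite gt_eqF//.
by rewrite lerBlDl.
Qed.

Definition jump_ratio (k : nat) : R := (rearr (t_ k.+1) - rearr (t_ k)) / hk k.

Lemma hk_gt0 k : 0 < hk k.
Proof.
apply: cell_weight_gt0 => //; exact: power_fundamental_gt0.
Qed.

Lemma jump_ratio_ge0 k : 0 <= jump_ratio k.
Proof.
rewrite divr_ge0 ?(ltW (hk_gt0 _))// subr_ge0 rearr_noninc//.
  by rewrite mulr_gt0// exprn_gt0.
rewrite ler_pM2l// ler_wiXn2l ?(ltW lam0)// invf_le1 ?(ltW C1)//.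
Qed.

Definition besov_constant : R := 2^-1 `^ a * 2 `^ (- s).

Lemma besov_constant_gt0 : 0 < besov_constant.
Proof. by rewrite mulr_gt0 ?powR_gt0// invr_gt0. Qed.

(** The radii in this cell lie in [2^-k, 2^(1-k)), where [modulus_ge_jump]
applies and r^-s >= 2^(s(k-1)). *)
Lemma besov_integrand_ge (k : nat) (r : R) : r_ k.+1 <= r < r_ k ->
  ((besov_constant * jump_ratio k)%:E <= (r `^ (- s))%:E * modulus X alpha f r)%E.
Proof.
rewrite /scale exprS mulVKf ?pnatr_eq0// => /andP[kr rk].
have k20 : 0 < 2^-1 ^+ k :> R by rewrite exprn_gt0// invr_gt0.
have r0 : 0 < r by apply: lt_le_trans kr.
have := modulus_ge_jump k r kr.
rewrite (_ : rearr (t_ k.+1) - rearr (t_ k) = jump_ratio k * hk k); last first.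
  by rewrite divfK// gt_eqF// hk_gt0.
have psi0 := power_fundamental_gt0 (t_ k.+1).
have tk0 : 0 < t_ k.+1 by rewrite mulr_gt0// exprn_gt0.
move=> H; apply: le_trans (lee_wpmul2l _ H); last by rewrite lee_fin powR_ge0.
rewrite -EFinM lee_fin /besov_constant /cell_weight lam_powR -/(t_ k.+1).
rewrite [leRHS](_ : _ = 2^-1 `^ a * jump_ratio k * (r `^ (- s) * 2 `^ (- s) ^+
  k)); last first.
  by field; rewrite gt_eqF// psi0.
have aJ := mulr_ge0 (powR_ge0 2^-1 a) (jump_ratio_ge0 k).
rewrite mulrAC ler_wpM2l//.
rewrite -powR_mulrn ?powR_ge0// powRAC -powRM ?(ltW r0) ?powR_ge0//.
rewrite !powRN lef_pV2 ?posrE ?powR_gt0 ?mulr_gt0 ?powR_gt0//.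
rewrite ge0_ler_powR ?nnegrE ?mulr_ge0 ?powR_ge0 ?(ltW s0) ?(ltW r0)//.
rewrite powR_mulrn//; move: rk; rewrite exprVn ltr_pdivlMr ?exprn_gt0//.
exact: ltW.
Qed.

Lemma sum_jump_ratio_le (p K : R) N : 0 < p -> 0 < K ->
  (besov_seminorm X s alpha p%:E f <= K%:E)%E ->
  \sum_(k < N) jump_ratio k `^ p <= 2 / besov_constant `^ p * K `^ p.
Proof.
move=> p0 K0 fK.
have kB := besov_constant_gt0.
set I := (\int[lebesgue_measure]_(r in `]0%R, +oo[)
  (((r `^ (- s))%:E * modulus X alpha f r) `^ p * (r^-1)%:E))%E.
have I0 : (0 <= I)%E.
  apply: integral_ge0 => r /=; rewrite in_itv/= andbT => r0.
  by rewrite mule_ge0 ?poweR_ge0// lee_fin invr_ge0 ltW.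
have IK : (I <= (K `^ p)%:E)%E.
  rewrite -(poweRe1 I0) -(mulVf (lt0r_neq0 p0)) poweRrM -poweR_EFin.
  apply: gt0_ler_poweR; rewrite ?(ltW p0)// ?in_itv/= ?leey ?andbT ?poweR_ge0//.
  by rewrite lee_fin ltW.
have tau0 k : 0 < r_ k :> R by rewrite mulr_gt0// exprn_gt0// invr_gt0.
have h1 : (2^-1 : R) < 1 by rewrite invf_lt1// ltr1n.
have := @sum_le_integral _ _ _ (@lebesgue_measure R) `]0%R, +oo[%classic
  (fun k => `[r_ k.+1, r_ k[%classic)
  (fun k => (besov_constant * jump_ratio k) `^ p / (r_ k))
  (fun r => (((r `^ (- s))%:E * modulus X alpha f r) `^ p * (r^-1)%:E)%E) N.
have -> : (\sum_(k < N) ((besov_constant * jump_ratio k) `^ p / (r_ k))%:E *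
    lebesgue_measure (`[(r_ k.+1)%R, (r_ k)%R[%classic : set R))%E =
    (besov_constant `^ p / 2 * \sum_(k < N) jump_ratio k `^ p)%:E.
  rewrite mulr_sumr -sumEFin; apply: eq_bigr => k _.
  rewrite lebesgue_measure_scale ?invr_gt0// -EFinM; congr EFin.
  rewrite powRM ?(ltW kB) ?jump_ratio_ge0//.
  have k20 : 0 < 2^-1 ^+ k :> R by rewrite exprn_gt0// invr_gt0.
  by field; rewrite gt_eqF.
move=> H; have {H} : ((besov_constant `^ p / 2 *
    \sum_(k < N) jump_ratio k `^ p)%:E <= (K `^ p)%:E)%E.
  apply: le_trans IK; apply: H.
  - exact: measurable_itv.
  - by move=> k; exact: measurable_itv.
  - move=> k _ r /=; rewrite !in_itv/= andbT => /andP[kr _]; exact: lt_le_trans kr.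
  - by apply: scale_trivIset; rewrite ?invr_gt0.
  - by move=> k; rewrite divr_ge0 ?powR_ge0// ltW.
  - move=> r /=; rewrite in_itv/= andbT => r0.
    by rewrite mule_ge0 ?poweR_ge0// lee_fin invr_ge0 ltW.
  - move=> k r _ /=; rewrite in_itv/= => kr.
    have r0 : 0 < r by case/andP: kr => kr _; exact: lt_le_trans kr.
    have bg0 := mulr_ge0 (ltW kB) (jump_ratio_ge0 k).
    rewrite EFinM; apply: lee_pmul.
    + by rewrite lee_fin powR_ge0.
    + by rewrite lee_fin invr_ge0 ltW.
    + rewrite -poweR_EFin; apply: gt0_ler_poweR; rewrite ?(ltW p0)//.
      * by rewrite in_itv/= leey lee_fin bg0.
      * by rewrite in_itv/= leey andbT mule_ge0 ?modulus_ge0// lee_fin powR_ge0.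
      * exact: besov_integrand_ge.
    + by rewrite lee_fin lef_pV2 ?posrE//; case/andP: kr => _ /ltW.
rewrite lee_fin => H; rewrite -ler_pdivrMl ?divr_gt0 ?powR_gt0//.
by rewrite invf_div.
Qed.

Lemma jump_ratio_le (K : R) k :
  (besov_seminorm X s alpha +oo f <= K%:E)%E ->
  jump_ratio k <= besov_constant^-1 * K.
Proof.
move=> fK; rewrite ler_pdivlMl ?besov_constant_gt0// -lee_fin.
have k20 : 0 < 2^-1 ^+ k :> R by rewrite exprn_gt0// invr_gt0.
have r0 : 0 < r_ k.+1 :> R by rewrite mulr_gt0// exprn_gt0// invr_gt0.
apply: le_trans fK; apply: le_trans (besov_integrand_ge k (r_ k.+1) _) _.
  rewrite lexx/= ltr_pM2l// exprS gtr_pMl// invf_lt1// ltr1n//.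
apply: ereal_sup_ubound; exists (r_ k.+1) => //=.
by rewrite in_itv/= r0.
Qed.

End fixed_function.

End oscillation.

(** * Sequences with controlled jumps *)

(** Takes alpha-th roots in estimates that are homogeneous in K. *)
Lemma powR_inv_le {R : realType} (alpha K y M : R) : 0 < alpha -> 0 <= K ->
  0 <= y -> 0 <= M -> y `^ alpha <= M * K `^ alpha -> y <= M `^ alpha^-1 * K.
Proof.
move=> alpha0 K0 y0 M0 yM.
rewrite -[leLHS]powRr1// -(mulfV (lt0r_neq0 alpha0)) powRrM.
rewrite -[X in _ <= _ * X]powRr1// -(mulfV (lt0r_neq0 alpha0)) powRrM.
rewrite -powRM ?powR_ge0// ge0_ler_powR ?nnegrE ?mulr_ge0 ?powR_ge0//.
by rewrite invr_ge0 ltW.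
Qed.

(** Here x k stands for F(t_k), so that h k * g k is the jump from one scale to
the next, and K for a common bound of the two norms of f. *)
Section jumps.
Context {R : realType}.
Variables (x h g : nat -> R) (alpha c0 K : R).
Hypotheses (x_ge0 : forall k, 0 <= x k) (xS : forall k, x k.+1 = x k + h k * g k)
  (h_gt0 : forall k, 0 < h k) (g_ge0 : forall k, 0 <= g k)
  (alpha01 : 0 < alpha <= 1) (c0_ge0 : 0 <= c0) (K_gt0 : 0 < K)
  (x0 : x 0%N <= c0 * K).

Let alpha0 : 0 < alpha. Proof. by case/andP: alpha01. Qed.
Let hg_ge0 k : 0 <= h k * g k. Proof. by rewrite mulr_ge0// ltW. Qed.
Let K_ge0 : 0 <= K := ltW K_gt0.

Lemma telescope_powR (e : R) (N : nat) : 0 < e <= 1 ->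
  x N `^ e <= x 0%N `^ e + \sum_(k < N) (h k * g k) `^ e.
Proof.
move=> e01; elim: N => [|N IH]; first by rewrite big_ord0 addr0.
rewrite big_ord_recr/= addrA xS; apply: le_trans (lerD IH (lexx _)).
exact: powR_subadditive.
Qed.

Let x0_powR (e : R) : 0 <= e -> x 0%N `^ e <= c0 `^ e * K `^ e.
Proof.
by move=> e0; rewrite -powRM// ge0_ler_powR ?nnegrE ?mulr_ge0.
Qed.

Let powR_inv (y M : R) : 0 <= y -> 0 <= M -> y `^ alpha <= M * K `^ alpha ->
  y <= M `^ alpha^-1 * K.
Proof. exact: powR_inv_le. Qed.

(** Young's inequality with exponents p / alpha and p / (p - alpha), applied to
g / K and h: once g is normalised, Young's inequality does the work of
Hoelder's. *)
Lemma jumps_bounded_lt (p CB S : R) (N : nat) : alpha < p -> 0 <= CB -> 0 <= S ->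
  \sum_(k < N) g k `^ p <= CB * K `^ p ->
  \sum_(k < N) h k `^ (alpha * p / (p - alpha)) <= S ->
  x N <= (c0 `^ alpha + CB + S) `^ alpha^-1 * K.
Proof.
move=> ap CB0 S0 gS hS; apply: powR_inv => //.
  by rewrite !addr_ge0 ?powR_ge0.
have p0 : 0 < p by apply: lt_trans ap.
have pa : 0 < p - alpha by rewrite subr_gt0.
apply: le_trans (telescope_powR alpha N alpha01) _.
rewrite -addrA mulrDl; apply: lerD; first exact/x0_powR/ltW.
have young k : (h k * g k) `^ alpha <=
    K `^ alpha * ((g k / K) `^ p + h k `^ (alpha * p / (p - alpha))).
  have gK0 : 0 <= g k / K by rewrite divr_ge0.
  have h0 := ltW (h_gt0 k).
  rewrite -[X in (_ * X) `^ _](divfK (lt0r_neq0 K_gt0)) mulrA [leLHS]powRM//;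
    last exact: mulr_ge0.
  rewrite mulrC ler_wpM2l ?powR_ge0// mulrC [leLHS]powRM//.
  have := @conjugate_powR R ((g k / K) `^ alpha) (h k `^ alpha) (p / alpha)
    (p / (p - alpha)) (powR_ge0 _ _) (powR_ge0 _ _) (divr_gt0 p0 alpha0)
    (divr_gt0 p0 pa).
  rewrite -!powRrM [alpha * (p / (p - alpha))]mulrA (_ : alpha * (p / alpha) =
    p); last first.
    by rewrite mulrCA divff ?mulr1// gt_eqF.
  rewrite !invf_div => H; apply: le_trans (H _) _.
    by rewrite -mulrDl addrC subrK divff// gt_eqF.
  rewrite lerD// ler_piMr ?powR_ge0// ler_pdivrMr// mul1r ltW//.
  by rewrite gtrBl.
apply: (@le_trans _ _ (\sum_(k < N) K `^ alpha *
    ((g k / K) `^ p + h k `^ (alpha * p / (p - alpha))))).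
  by apply: ler_sum => k _; exact: young.
rewrite -mulr_sumr mulrC ler_wpM2r ?powR_ge0// big_split/= lerD//.
have E k : (g k / K) `^ p = g k `^ p / K `^ p.
  by rewrite powRM ?invr_ge0// -powR_inv1// -powRrM mulN1r powRN.
under eq_bigr do rewrite E.
by rewrite -mulr_suml ler_pdivrMr ?powR_gt0.
Qed.

Lemma jumps_powR_bounded_y (G : R) (N : nat) : 0 <= G -> (forall k, g k <= G * K) ->
  x N `^ alpha <=
  (c0 `^ alpha + G `^ alpha) * (1 + \sum_(k < N) h k `^ alpha) * K `^ alpha.
Proof.
move=> G0 gG; apply: le_trans (telescope_powR alpha N alpha01) _.
set S := \sum_(k < N) h k `^ alpha.
have S0 : 0 <= S by apply: sumr_ge0 => *; exact: powR_ge0.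
have H : \sum_(k < N) (h k * g k) `^ alpha <= G `^ alpha * S * K `^ alpha.
  rewrite /S mulr_sumr mulr_suml; apply: ler_sum => k _.
  have h0 := ltW (h_gt0 k).
  rewrite powRM// mulrAC mulrC ler_wpM2r ?powR_ge0//.
  by rewrite -powRM// ge0_ler_powR ?nnegrE ?mulr_ge0 ?(ltW alpha0).
have := x0_powR alpha (ltW alpha0).
have := powR_ge0 c0 alpha; have := powR_ge0 G alpha; have := powR_ge0 K alpha.
set k := K `^ _ in H *; set c := c0 `^ _; set u := G `^ _ in H *.
move=> k0 u0 c0' xc; apply: le_trans (lerD xc H) _.
rewrite -mulrDl ler_wpM2r//; nra.
Qed.

Lemma jumps_bounded_y (G S : R) (N : nat) : 0 <= G -> (forall k, g k <= G * K) ->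
  \sum_(k < N) h k `^ alpha <= S -> 0 <= S ->
  x N <= ((c0 `^ alpha + G `^ alpha) * (1 + S)) `^ alpha^-1 * K.
Proof.
move=> G0 gG hS S0; apply: powR_inv => //.
  by rewrite mulr_ge0 ?addr_ge0 ?powR_ge0.
apply: le_trans (jumps_powR_bounded_y G N G0 gG) _.
by rewrite ler_wpM2r ?powR_ge0// ler_wpM2l ?addr_ge0 ?powR_ge0// lerD2l.
Qed.

(** After normalisation by the l^p norm every term of g is at most 1, so its
alpha-th power is at most its p-th power. *)
Lemma jumps_bounded_ge (p CB H : R) (N : nat) : 0 < p -> p <= alpha -> 0 < CB
  -> 0 <= H ->
  \sum_(k < N) g k `^ p <= CB * K `^ p -> (forall k, h k <= H) ->
  x N <= (c0 `^ alpha + H `^ alpha * CB `^ (alpha / p)) `^ alpha^-1 * K.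
Proof.
move=> p0 pa CB0 H0 gS hH; apply: powR_inv => //.
  by rewrite addr_ge0 ?mulr_ge0 ?powR_ge0.
apply: le_trans (telescope_powR alpha N alpha01) _.
rewrite mulrDl; apply: lerD; first exact/x0_powR/ltW.
pose L := CB `^ p^-1 * K.
have L0 : 0 < L by rewrite mulr_gt0 ?powR_gt0.
have Lp : L `^ p = CB * K `^ p.
  by rewrite /L powRM ?powR_ge0// -powRrM mulVf ?gt_eqF// powRr1// ltW.
have La : L `^ alpha = CB `^ (alpha / p) * K `^ alpha.
  by rewrite /L powRM ?powR_ge0// -powRrM [p^-1 * _]mulrC.
rewrite -mulrA -La.
have E e k : (g k / L) `^ e = g k `^ e / L `^ e.
  have L0' := ltW L0.
  by rewrite powRM ?invr_ge0// -powR_inv1// -powRrM mulN1r powRN.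
have sum1 : \sum_(k < N) (g k / L) `^ p <= 1.
  under eq_bigr do rewrite E.
  by rewrite -mulr_suml ler_pdivrMr ?powR_gt0// Lp mul1r.
have gL (k : 'I_N) : (g k / L) `^ alpha <= (g k / L) `^ p.
  have gL0 : 0 <= g k / L by rewrite divr_ge0// ltW.
  have [->|gLN0] := eqVneq (g k / L) 0; first by rewrite !powR0 ?gt_eqF.
  apply: ger_powR => //; rewrite lt0r gLN0 gL0/=.
  have : (g k / L) `^ p <= 1 `^ p.
    rewrite powR1; apply: le_trans sum1.
    by rewrite (bigD1 k)//= lerDl; apply: sumr_ge0 => *; exact: powR_ge0.
  move/(@ge0_ler_powR _ p^-1 _ _ _ _ _); rewrite ?invr_ge0 ?nnegrE ?powR_ge0//.
  move=> /(_ (ltW p0) isT isT); rewrite -!powRrM divff ?gt_eqF//.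
  by rewrite !powRr1.
apply: (@le_trans _ _ (\sum_(k < N) H `^ alpha * L `^ alpha * (g k / L) `^ p)).
  apply: ler_sum => k _; have h0 := ltW (h_gt0 k).
  rewrite powRM//; apply: (@le_trans _ _ (H `^ alpha * g k `^ alpha)).
    by rewrite ler_wpM2r ?powR_ge0// ge0_ler_powR ?nnegrE ?(ltW alpha0).
  rewrite -mulrA ler_wpM2l ?powR_ge0//.
  apply: le_trans (ler_wpM2l (powR_ge0 _ _) (gL k)).
  by rewrite E mulrC divfK// gt_eqF// powR_gt0.
by rewrite -mulr_sumr ler_piMr// mulr_ge0 ?powR_ge0.
Qed.

(** [discrete_hardy] with exponent p / alpha, weights w = h^gam for
gam = alpha p / (p - alpha), and b = (h g)^alpha / w. The value of gam is the
one for which w b^(p / alpha) = g^p. *)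
Lemma jumps_hardy (p CB : R) (N : nat) : alpha < p -> 0 <= CB ->
  (forall n, \sum_(k < n) g k `^ p <= CB * K `^ p) ->
  \sum_(k < N) x k.+1 `^ p * (h k `^ (alpha * p / (p - alpha)) /
     (1 + \sum_(j < k.+1) h j `^ (alpha * p / (p - alpha))) `^ (p / alpha)) <=
  2 / (p / alpha - 1) * (2 `^ (p / alpha - 1) * CB + c0 `^ p) * K `^ p.
Proof.
move=> ap CB0 gS; set gam := alpha * p / (p - alpha).
have p0 : 0 < p by apply: lt_trans ap.
have pa : 0 < p - alpha by rewrite subr_gt0.
pose P := p / alpha.
have P1 : 1 < P by rewrite ltr_pdivlMr// mul1r.
have Pm : 0 < P - 1 by rewrite subr_gt0.
pose w k := h k `^ gam.
have w0 k : 0 < w k by rewrite powR_gt0.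
pose bb k := (h k * g k) `^ alpha / w k.
pose M k := 1 + \sum_(j < k) w j.
pose B k := x 0%N `^ alpha + \sum_(j < k) w j * bb j.
have BE k : B k = x 0%N `^ alpha + \sum_(j < k) (h j * g j) `^ alpha.
  by congr (_ + _); apply: eq_bigr => j _; rewrite /bb mulrC divfK// gt_eqF.
have xB k : x k `^ alpha <= B k by rewrite BE; exact: telescope_powR.
have M0 k : 0 < M k.
  by rewrite ltr_wpDr//; apply: sumr_ge0 => j _; exact: ltW.
have xBp k : x k `^ p <= B k `^ P.
  have -> : x k `^ p = (x k `^ alpha) `^ P.
    by rewrite -powRrM /P mulrCA divff ?mulr1// gt_eqF.
  rewrite ge0_ler_powR ?nnegrE ?powR_ge0 ?(le_trans _ (xB k)) ?powR_ge0//.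
  by rewrite ltW// (lt_trans _ P1).
have wb k : w k * bb k `^ P = g k `^ p.
  have h0 := h_gt0 k; have h0' := ltW h0; have w0' := ltW (w0 k).
  rewrite /bb powRM ?powR_ge0 ?invr_ge0// -powRrM (_ : alpha * P = p); last first.
    by rewrite /P mulrCA divff ?mulr1// gt_eqF.
  rewrite -powR_inv1// -powRrM powRM// /w -powRrM.
  have hE : h k `^ gam * (h k `^ p * h k `^ (gam * (-1 * P))) = 1.
    rewrite -!powRD ?(gt_eqF h0) ?implybT//.
    rewrite (_ : gam + _ = 0) ?powRr0// /gam /P; field.
    by rewrite !gt_eqF.
  rewrite [LHS](_ : _ = h k `^ gam * (h k `^ p * h k `^ (gam * (-1 * P))) * g k
    `^ p).
    by rewrite hE mul1r.
  by ring.
apply: (@le_trans _ _ (\sum_(k < N) w k * (B k.+1 / M k.+1) `^ P)).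
  apply: ler_sum => k _; rewrite mulrCA ler_wpM2l ?(ltW (w0 k))//.
  have B0 : 0 <= B k.+1 by apply: le_trans (xB _); exact: powR_ge0.
  have M0' := ltW (M0 k.+1).
  rewrite powRM ?invr_ge0// -[X in _ <= _ * X `^ _]powR_inv1// -powRrM mulN1r powRN.
  by rewrite ler_wpM2r ?xBp// invr_ge0 powR_ge0.
apply: le_trans (@discrete_hardy R P w bb M B P1 _ _ _ _ _ _ N) _.
- by move=> k; exact: ltW.
- by move=> k; rewrite divr_ge0 ?powR_ge0// ltW.
- exact: M0.
- by rewrite /B big_ord0 addr0 powR_ge0.
- by move=> k; rewrite /M big_ord_recr addrA.
- by move=> k; rewrite /B big_ord_recr addrA.
under eq_bigr do rewrite wb.
rewrite -[leRHS]mulrA ler_wpM2l ?divr_ge0 ?(ltW Pm)//.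
rewrite [leRHS]mulrDl; apply: lerD.
  by rewrite -[leRHS]mulrA ler_wpM2l ?powR_ge0.
rewrite /M /B !big_ord0 !addr0 mul1r divr1 -powRrM.
rewrite (_ : alpha * P = p); last by rewrite /P mulrCA divff ?mulr1// gt_eqF.
exact/x0_powR/ltW.
Qed.

End jumps.

(** * The embeddings *)

Lemma nneseries_le {R : realType} (u : nat -> \bar R) (B : \bar R) :
  (forall k, 0 <= u k)%E -> (forall N, \sum_(k < N) u k <= B)%E ->
  (\sum_(k <oo) u k <= B)%E.
Proof.
move=> u0 uB; apply: lime_le; first exact: is_cvg_nneseries.
by apply: nearW => n; rewrite big_mkord.
Qed.

(** Turns a bound for the integral of a p-th power into one for the norm. *)
Lemma poweR_root_le {R : realType} (C K p : R) (I : \bar R) :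
  0 <= C -> 0 <= K -> 0 < p -> (0 <= I)%E -> (I <= (C * K `^ p)%:E)%E ->
  (I `^ p^-1 <= (C `^ p^-1 * K)%:E)%E.
Proof.
move=> C0 K0 p0 I0 IK.
have CK : 0 <= C * K `^ p by rewrite mulr_ge0 ?powR_ge0.
apply: (@le_trans _ _ ((C * K `^ p)%:E `^ p^-1)%E).
  by apply: gt0_ler_poweR; rewrite ?invr_ge0 ?(ltW p0)// in_itv/= leey andbT.
rewrite poweR_EFin lee_fin powRM ?powR_ge0//.
by rewrite -powRrM mulfV ?gt_eqF// powRr1.
Qed.

Section embedding.
Context {R : realType} {d : measure_display} {T : metricMeasurableType R d}.
Context {mu : {measure set T -> \bar R}} (X : ri_space mu).
Hypotheses (doubling_mu : doubling_space mu) (mu_infinite : mu [set: T] = +oo%E)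
  (concave_phi :
    @convex_function R R^o `]0%R, +oo[ (fun t => (- fundamental X t)%R)).
Variables (alpha s b : R).
Hypotheses (alpha01 : 0 < alpha <= 1) (s0 : 0 < s) (b01 : 0 < b <= 1)
  (mu_ball1 : forall x : T, (b%:E <= mu (ball x 1))%E).

Local Notation lam := ((inf (doubling_constant mu))^-1).
Let a := alpha^-1.
Let beta := b / 2.
Let psi := power_fundamental X alpha.
Let theta := s / upper_dimension mu.
Local Notation t_ := (scale beta lam).
Local Notation hk := (cell_weight psi theta beta lam).
Local Notation g := (jump_ratio X alpha s b).
Local Notation besov := (besov_seminorm X s alpha).

Let alpha0 : 0 < alpha. Proof. by case/andP: alpha01. Qed.
Let b0 : 0 < b. Proof. by case/andP: b01. Qed.
Let beta0 : 0 < beta. Proof. by rewrite divr_gt0. Qed.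
Let beta1 : beta < 1. Proof. by case/andP: b01 => _ b1; rewrite /beta; lra. Qed.
Let C1 : 1 < inf (doubling_constant mu).
Proof. exact: inf_doubling_constant_gt1. Qed.
Let lam0 : 0 < lam. Proof. by rewrite invr_gt0 (lt_trans _ C1). Qed.
Let lam1 : lam < 1. Proof. by rewrite invf_lt1// (lt_trans _ C1). Qed.
Let theta0 : 0 < theta.
Proof. by rewrite divr_gt0// upper_dimension_gt0. Qed.
Let t_gt0 k : 0 < t_ k. Proof. exact: scale_gt0. Qed.
Let t0E : t_ 0 = beta. Proof. exact: scale0. Qed.

Let psi0 (z : R) : 0 < z -> 0 < psi z.
Proof. exact: power_fundamental_gt0. Qed.
Let psi_nd (z1 z2 : R) : 0 < z1 -> z1 <= z2 -> psi z1 <= psi z2.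
Proof. exact: power_fundamental_nd. Qed.
Let psi_growth (c z1 z2 : R) : 0 < z1 -> z1 <= z2 -> z2 <= c * z1 ->
  psi z2 <= (2 * c) `^ a * psi z1.
Proof. exact: power_fundamental_growth. Qed.

Let hk0 k : 0 < hk k. Proof. exact: cell_weight_gt0. Qed.

Let c0 : R := 1 + beta `^ (- alpha^-1).
Let c0_gt0 : 0 < c0. Proof. by rewrite ltr_wpDr// powR_ge0. Qed.

Lemma besov_seminorm_ge0 (q : \bar R) f : (0 < q)%E -> (0 <= besov q f)%E.
Proof.
case: q => [p||]// _; first exact: poweR_ge0.
apply: (@le_trans _ _ ((1 `^ (- s))%:E * modulus X alpha f 1)%E).
  by rewrite mule_ge0 ?modulus_ge0// lee_fin powR_ge0.
by apply: ereal_sup_ubound; exists 1 => //=; rewrite in_itv/= ltr01.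
Qed.

Lemma sum_norm_ge0 f : (0 <= sum_norm mu alpha f)%E.
Proof.
apply: le_ereal_inf_tmp => _ [f0 [f1 [_ _ _ ->]]].
by rewrite adde_ge0// Lnorm_ge0.
Qed.

(** A single positive real K dominating both norms makes all estimates
homogeneous; being positive, it can be divided by even if f = 0. *)
Definition controlled (q : \bar R) (f : T -> R) (K : R) : Prop :=
  [/\ sum_space mu alpha f, 0 < K, (besov q f <= K%:E)%E &
      (sum_norm mu alpha f <= K%:E)%E].

(** K may be any real above the sum of the two norms; if that sum is +oo there
is nothing to prove. *)
Lemma bound_by_controlled (q : \bar R) (N : (T -> R) -> \bar R) : (0 < q)%E ->
  (exists2 C : R, 0 < C &
     forall f K, controlled q f K -> (N f <= (C * K)%:E)%E) ->
  exists2 C : R, 0 < C & forall f, sum_space mu alpha f ->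
    (N f <= C%:E * (besov q f + sum_norm mu alpha f))%E.
Proof.
move=> q0 [C C_gt0 NC]; exists C => // f ff.
have B0 := besov_seminorm_ge0 q f q0; have S0 := sum_norm_ge0 f.
move: B0 S0 (NC f); rewrite /controlled.
case: (besov q f) (sum_norm mu alpha f) => [B||] [S||]//=; last 3 first.
- by move=> *; rewrite gt0_muley ?leey.
- by move=> *; rewrite gt0_muley ?leey.
- by move=> *; rewrite gt0_muley ?leey.
rewrite !lee_fin => B0 S0 H; apply/lee_addgt0Pr => e e0.
have eC : 0 < e / C by rewrite divr_gt0.
apply: le_trans (H (B + S + e / C) _) _.
  by split; rewrite ?lee_fin//; lra.
by rewrite mulrDr [C * (e / C)]mulrC divfK ?gt_eqF// EFinD EFinM EFinD.
Qed.

Section controlled_function.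
Variables (q : \bar R) (f : T -> R) (K : R).
Hypothesis fK : controlled q f K.

Let ff : sum_space mu alpha f. Proof. by case: fK. Qed.
Let K0 : 0 < K. Proof. by case: fK. Qed.
Local Notation F := (@rearr R d T mu f).

Lemma controlled_jump k : F (t_ k.+1) = F (t_ k) + hk k * g f k.
Proof. by rewrite /jump_ratio mulrC divfK ?gt_eqF// addrC subrK. Qed.

Lemma controlled_jump_ge0 k : 0 <= g f k.
Proof. exact: jump_ratio_ge0. Qed.

Lemma controlled_rearr0 : F (t_ 0) <= c0 * K.
Proof.
rewrite t0E -lee_fin -(rearrE mu_infinite alpha alpha0 f ff)//.
apply: le_trans (rearrangement_le_sum_norm mu_infinite f alpha beta alpha0 beta0) _.
rewrite -/c0 EFinM lee_wpmul2l ?lee_fin ?(ltW c0_gt0)//.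
by case: fK.
Qed.

Lemma Lnorm_oo_le_rearr (M : R) : (forall N, F (t_ N) <= M) ->
  ('N[mu]_(+oo)[EFin \o f] <= M%:E)%E.
Proof.
move=> FM; apply: Lnorm_oo_le_rearrangement => //; first by case: ff.
move=> t t0; rewrite (rearrE mu_infinite alpha alpha0 f ff)// lee_fin.
suff [N Nt] : exists N, t_ N <= t.
  by apply: le_trans (FM N); apply: (rearr_noninc mu_infinite alpha alpha0 f ff).
have [bt|tb] := leP beta t; first by exists 0%N; rewrite t0E.
have [//|k /andP[kt _]] := @scale_cell R beta lam beta0 lam0 lam1 t _.
  by rewrite t0.
by exists k.+1.
Qed.

End controlled_function.

Local Notation m gam := (tail_integral (embedding_density psi theta gam)).

Let tail_ge0 gam (t : R) : 0 < t -> (0 <= m gam t)%E.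
Proof.
move=> t0; apply: integral_ge0 => z /=; rewrite in_itv/= => /andP[tz _].
by rewrite lee_fin divr_ge0 ?powR_ge0// (le_trans (ltW t0)).
Qed.

Let tail_fin gam : 0 < gam -> forall t : R, 0 < t -> m gam t \is a fin_num.
Proof.
move=> gam0 t t0; apply: tail_integral_fin => //.
  by move=> z z0; rewrite divr_ge0 ?powR_ge0// ltW.
exact: (weight_bounded psi theta psi0 psi_nd theta0).
Qed.

Let sum_weights_le gam : 0 < gam -> (m gam 0%R < +oo)%E ->
  exists2 S, 0 <= S & forall N, \sum_(k < N) hk k `^ gam <= S.
Proof.
move=> gam0 moo.
have mE : m gam 0 = (fine (m gam 0))%:E.
  rewrite fineK// ge0_fin_numE//; apply: integral_ge0 => z /=.
  by rewrite in_itv/= => /andP[z0 _]; rewrite lee_fin divr_ge0 ?powR_ge0.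
have c_gt0 := tail_constant_gt0 a theta beta lam beta0 lam0 lam1 gam.
exists ((tail_constant a theta beta lam gam)^-1 * Num.max 0 (fine (m gam 0))).
  by rewrite mulr_ge0 ?invr_ge0 ?(ltW c_gt0)// le_max lexx.
move=> N; rewrite ler_pdivlMl// le_max; apply/orP; right.
rewrite -lee_fin -mE; apply: sum_cell_weight_le => //.
exact: ltW (t_gt0 N).
Qed.

Lemma Lnorm_oo_bound_lt (p : R) : alpha < p ->
  (m (alpha * p / (p - alpha)) 0%R < +oo)%E ->
  exists2 C : R, 0 < C & forall f K, controlled p%:E f K ->
    ('N[mu]_(+oo)[EFin \o f] <= (C * K)%:E)%E.
Proof.
move=> ap; have p0 : 0 < p by apply: lt_trans ap.
have gam0 : 0 < alpha * p / (p - alpha) by rewrite divr_gt0 ?mulr_gt0// subr_gt0.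
move=> /(sum_weights_le _ gam0)[S S0 hS].
pose CB := 2 / besov_constant alpha s `^ p.
have CB0 : 0 <= CB by rewrite divr_ge0// powR_ge0.
exists ((c0 `^ alpha + CB + S) `^ alpha^-1) => [|f K fK].
  by rewrite powR_gt0// !ltr_wpDr// powR_gt0.
apply: (Lnorm_oo_le_rearr _ _ _ fK) => N; have [ff K0 fB _] := fK.
apply: (@jumps_bounded_lt R (fun k => rearr f (t_ k)) hk (g f) alpha c0 K
  _ _ _ _ _ _ _ _ p CB S N) => //.
- by move=> k; exact: rearr_ge0.
- by move=> k; exact: controlled_jump.
- by move=> k; exact: controlled_jump_ge0 _ _ _ fK k.
- exact: ltW.
- exact: controlled_rearr0 _ _ _ fK.
- exact: sum_jump_ratio_le.
Qed.

Lemma Lnorm_oo_bound_y : (m alpha 0%R < +oo)%E ->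
  exists2 C : R, 0 < C & forall f K, controlled +oo%E f K ->
    ('N[mu]_(+oo)[EFin \o f] <= (C * K)%:E)%E.
Proof.
move=> /(sum_weights_le _ alpha0)[S S0 hS].
pose G := (besov_constant alpha s)^-1.
have G0 : 0 <= G by rewrite invr_ge0 ltW// besov_constant_gt0.
exists (((c0 `^ alpha + G `^ alpha) * (1 + S)) `^ alpha^-1) => [|f K fK].
  by rewrite powR_gt0// mulr_gt0 ?ltr_wpDr ?powR_ge0 ?powR_gt0.
apply: (Lnorm_oo_le_rearr _ _ _ fK) => N; have [ff K0 fB _] := fK.
apply: (@jumps_bounded_y R (fun k => rearr f (t_ k)) hk (g f) alpha c0 K
  _ _ _ _ _ _ _ _ G S N) => //.
- by move=> k; exact: rearr_ge0.
- by move=> k; exact: controlled_jump.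
- by move=> k; exact: controlled_jump_ge0 _ _ _ fK k.
- exact: ltW.
- exact: controlled_rearr0 _ _ _ fK.
- by move=> k; exact: jump_ratio_le.
Qed.

Lemma Lnorm_oo_bound_ge (p M : R) : 0 < p -> p <= alpha ->
  (forall z : R, 0 < z < 1 -> z `^ theta / psi z <= M) ->
  exists2 C : R, 0 < C & forall f K, controlled p%:E f K ->
    ('N[mu]_(+oo)[EFin \o f] <= (C * K)%:E)%E.
Proof.
move=> p0 pa hM.
pose CB := 2 / besov_constant alpha s `^ p.
have CB0 : 0 < CB by rewrite divr_gt0// powR_gt0// besov_constant_gt0.
pose br := beta `^ theta * lam `^ theta.
have br0 : 0 < br by rewrite mulr_gt0 ?powR_gt0.
have hH k : hk k <= br^-1 * M.
  rewrite ler_pdivlMl// -cell_weightE//; apply: hM; rewrite t_gt0/=.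
  apply: le_lt_trans beta1; rewrite -[leRHS]t0E.
  by apply: scale_le => //; exact: ltW.
have H0 : 0 <= br^-1 * M by apply: le_trans (hH 0%N); exact: ltW.
exists ((c0 `^ alpha + (br^-1 * M) `^ alpha * CB `^ (alpha / p)) `^ alpha^-1)
  => [|f K fK].
  by rewrite powR_gt0// ltr_wpDr ?powR_gt0// mulr_ge0 ?powR_ge0.
apply: (Lnorm_oo_le_rearr _ _ _ fK) => N; have [ff K0 fB _] := fK.
apply: (@jumps_bounded_ge R (fun k => rearr f (t_ k)) hk (g f) alpha c0 K
  _ _ _ _ _ _ _ _ p CB _ N) => //.
- by move=> k; exact: rearr_ge0.
- by move=> k; exact: controlled_jump.
- by move=> k; exact: controlled_jump_ge0 _ _ _ fK k.
- exact: ltW.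
- exact: controlled_rearr0 _ _ _ fK.
- exact: sum_jump_ratio_le.
Qed.

Let sum_weights_le_tail gam : 0 < gam -> exists2 C4 : R, 0 < C4 &
  forall (t mt : R) k, 0 < t -> t <= t_ k -> m gam t = mt%:E ->
  1 + \sum_(j < k.+1) hk j `^ gam <= C4 * (1 + mt).
Proof.
move=> gam0.
have [C4 C40 HC4] := sum_cell_weight_le1 psi a theta beta lam psi0 psi_nd
  psi_growth theta0 beta0 beta1 lam0 lam1 gam gam0.
exists C4 => // t mt k t0 tk mE; have := HC4 t k t0 tk.
by rewrite -/(m gam t) mE -EFinD -EFinM lee_fin.
Qed.

(** The summand c0 of the constant accounts for t in [beta, 1], where F is
bounded by F(beta) and 1 + m >= 1. *)
Lemma weak_type_bound_y :
  exists2 C : R, 0 < C & forall f K, controlled +oo%E f K ->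
    (ereal_sup [set rearrangement mu f t / (1 + m alpha t) `^ alpha^-1 |
       t in `]0%R, 1%R]] <= (C * K)%:E)%E.
Proof.
pose G := (besov_constant alpha s)^-1.
have G0 : 0 <= G by rewrite invr_ge0 ltW// besov_constant_gt0.
have [C4 C40 HC4] := sum_weights_le_tail _ alpha0.
pose C' := (c0 `^ alpha + G `^ alpha) * C4.
have C'0 : 0 < C' by rewrite mulr_gt0// ltr_wpDr ?powR_ge0 ?powR_gt0.
exists (C' `^ alpha^-1 + c0) => [|f K fK]; first by rewrite addr_gt0 ?powR_gt0.
have [ff K0 fB _] := fK.
have noninc := @rearr_noninc _ _ _ _ mu_infinite alpha alpha0 f ff.
apply: ge_ereal_sup => _ [t /= t01 <-]; move: t01; rewrite in_itv/= => /andP[t0 t1].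
rewrite (rearrE mu_infinite alpha alpha0 f ff)//.
have := HC4 t; have := tail_fin _ alpha0 t t0; have := tail_ge0 alpha t t0.
case: (m alpha t) => [mt||]//; rewrite lee_fin => mt0 _ {}HC4.
have m1 : 0 < 1 + mt by rewrite ltr_wpDr.
rewrite -EFinD poweR_EFin inver gt_eqF ?powR_gt0// lee_fin.
rewrite ler_pdivrMr ?powR_gt0//.
have [bt|tb] := leP beta t.
  apply: (@le_trans _ _ (c0 * K)).
    by apply: le_trans (controlled_rearr0 _ _ _ fK); rewrite t0E; exact: noninc.
  apply: (@le_trans _ _ ((C' `^ alpha^-1 + c0) * K)).
    by rewrite ler_pM2r// lerDr powR_ge0.
  rewrite ler_peMr ?mulr_ge0 ?addr_ge0 ?powR_ge0 ?(ltW K0) ?(ltW c0_gt0)//.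
  rewrite -[leLHS](powRr0 (1 + mt)) ler_powR ?invr_ge0 ?(ltW alpha0)//.
  by rewrite lerDl.
have [|k /andP[kt tk]] := @scale_cell R beta lam beta0 lam0 lam1 t _.
  by rewrite t0.
apply: (@le_trans _ _ (@rearr R d T mu f (t_ k.+1))); first exact: noninc.
have hG : forall k, g f k <= G * K by move=> j; exact: jump_ratio_le.
have := @jumps_powR_bounded_y R (fun k => rearr f (t_ k)) hk (g f) alpha c0 K
  (fun k => rearr_ge0 f _) (controlled_jump f) hk0 (controlled_jump_ge0 _ _ _ fK)
  alpha01 (ltW c0_gt0) K0 (controlled_rearr0 _ _ _ fK) G k.+1 G0 hG.
set S := \sum_(j < k.+1) _ => FS.
have SM : 1 + S <= C4 * (1 + mt) by apply: HC4 => //; exact: ltW.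
have F0 : 0 <= @rearr R d T mu f (t_ k.+1) by exact: rearr_ge0.
have {FS} FC : @rearr R d T mu f (t_ k.+1) `^ alpha <= (C' * (1 + mt)) * K `^ alpha.
  apply: le_trans FS _; rewrite ler_wpM2r ?powR_ge0// /C' -mulrA.
  by rewrite ler_wpM2l ?addr_ge0 ?powR_ge0.
have C'm : 0 <= C' * (1 + mt) by rewrite mulr_ge0 ?(ltW C'0) ?(ltW m1).
have := @powR_inv_le R alpha K _ _ alpha0 (ltW K0) F0 C'm FC.
move=> /le_trans; apply; rewrite powRM ?(ltW C'0) ?(ltW m1)//.
rewrite mulrAC ler_wpM2r ?powR_ge0// ler_pM2r//.
by rewrite lerDl ltW.
Qed.

(** The integrand is bounded by a constant on [beta, 1) and on each cell, and
the resulting series is the left side of [jumps_hardy]. *)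
Lemma strong_type_bound_lt (p : R) : alpha < p ->
  exists2 C : R, 0 < C & forall f K, controlled p%:E f K ->
    ((\int[lebesgue_measure]_(t in `]0%R, 1%R[)
       (rearrangement mu f t `^ p *
         (`|derive1 (fine \o m (alpha * p / (p - alpha))) t|%:E /
            (1 + m (alpha * p / (p - alpha)) t) `^ (p / alpha)))) `^ p^-1
     <= (C * K)%:E)%E.
Proof.
move=> ap; set gam := alpha * p / (p - alpha).
have p0 : 0 < p by apply: lt_trans ap.
have gam0 : 0 < gam by rewrite divr_gt0 ?mulr_gt0// subr_gt0.
have [C4 C40 HC4] := sum_weights_le_tail _ gam0.
have [C5 C50 HC5] := derive1_tail_cell_le psi a theta beta lam psi0 psi_nd
  psi_growth theta0 beta0 beta1 lam0 lam1 gam gam0.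
have [L L0 HL] := derive1_tail_top_le psi theta beta psi0 psi_nd theta0 beta0
  gam gam0.
pose P := p / alpha.
have P1 : 1 < P by rewrite ltr_pdivlMr// mul1r.
have P0 : 0 < P by apply: lt_trans P1.
pose CB := 2 / besov_constant alpha s `^ p.
have CB0 : 0 <= CB by rewrite divr_ge0// powR_ge0.
pose CH := 2 / (P - 1) * (2 `^ (P - 1) * CB + c0 `^ p).
have CH0 : 0 <= CH.
  apply: mulr_ge0; first by rewrite divr_ge0// subr_ge0 ltW.
  by apply: addr_ge0; [exact: mulr_ge0 (powR_ge0 _ _) CB0|exact: powR_ge0].
pose CC := c0 `^ p * L + C5 * C4 `^ P * CH + 1.
have CC0 : 0 < CC.
  rewrite ltr_wpDl// addr_ge0//; first exact: mulr_ge0 (powR_ge0 _ _) L0.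
  by apply: mulr_ge0 => //; exact: mulr_ge0 (ltW C50) (powR_ge0 _ _).
exists (CC `^ p^-1) => [|f K fK]; first exact: powR_gt0.
have [ff K0 fB _] := fK.
have noninc := @rearr_noninc _ _ _ _ mu_infinite alpha alpha0 f ff.
pose x k := @rearr R d T mu f (t_ k).
have x0 k : 0 <= x k by exact: rearr_ge0.
pose M k := 1 + \sum_(j < k) hk j `^ gam.
have M0 k : 0 < M k by rewrite ltr_wpDr//; apply: sumr_ge0 => *; exact: powR_ge0.
(* the index is shifted: A 0 is [beta, 1) and A k.+1 is the k-th cell *)
pose A k := if k is k'.+1 then `[t_ k'.+1, t_ k'[%classic else `[beta,
  1[%classic : set R.
pose cc k := if k is k'.+1 then
  x k'.+1 `^ p * (C5 * (hk k' `^ gam / t_ k') * (C4 `^ P / M k'.+1 `^ P))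
  else (c0 * K) `^ p * L.
have cc0 k : 0 <= cc k.
  case: k => [|k]; first by rewrite /cc mulr_ge0 ?powR_ge0.
  have tk := ltW (t_gt0 k).
  apply: mulr_ge0; first exact: powR_ge0.
  apply: mulr_ge0; last by rewrite divr_ge0 ?powR_ge0.
  by apply: mulr_ge0; [exact: ltW|rewrite divr_ge0 ?powR_ge0].
set I := (\int[_]_(t in _) _)%E.
suff H : (I <= (CC * K `^ p)%:E)%E.
  have I0 : (0 <= I)%E.
    apply: integral_ge0 => t /=; rewrite in_itv/= => /andP[t0 _].
    rewrite mule_ge0 ?poweR_ge0// mule_ge0 ?lee_fin// inve_ge0 poweR_ge0//.
  exact: poweR_root_le (ltW CC0) (ltW K0) p0 I0 H.
apply: le_trans (@integral_le_nneseries _ _ R lebesgue_measure _ A cc _ _ _ _ _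
  _ _) _.
- exact: measurable_itv.
- by case=> [|k]; exact: measurable_itv.
- move=> t /=; rewrite in_itv/= => /andP[t0 t1].
  have [bt|tb] := leP beta t; first by exists 0%N => //=; rewrite in_itv/= bt.
  have [|k ktk] := @scale_cell R beta lam beta0 lam0 lam1 t _.
    by rewrite t0.
  by exists k.+1 => //=; rewrite in_itv.
- exact: cc0.
- move=> t /=; rewrite in_itv/= => /andP[t0 _].
  rewrite mule_ge0 ?poweR_ge0// mule_ge0 ?lee_fin// inve_ge0 poweR_ge0//.
- move=> k t /=; rewrite in_itv/= => /andP[t0 t1] kt.
  rewrite (rearrE mu_infinite alpha alpha0 f ff)//.
  have := HC4 t; have := tail_fin _ gam0 t t0; have := tail_ge0 gam t t0.
  case: (m gam t) => [mt||]//; rewrite lee_fin => mt0 _ HC4t.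
  have m1 : 0 < 1 + mt by rewrite ltr_wpDr.
  rewrite -EFinD !poweR_EFin inver gt_eqF ?powR_gt0// -!EFinM lee_fin -/P.
  case: k kt => [|k] /=; rewrite in_itv/= => kt.
    apply: ler_pM; rewrite ?powR_ge0 ?mulr_ge0 ?invr_ge0 ?powR_ge0//.
      rewrite ge0_ler_powR ?nnegrE ?(ltW p0) ?mulr_ge0 ?(ltW c0_gt0) ?(ltW K0)
        ?rearr_ge0//.
      apply: le_trans (controlled_rearr0 _ _ _ fK); rewrite t0E; apply: noninc
        => //.
      by case/andP: kt.
    apply: (@le_trans _ _ (L * 1)); last by rewrite mulr1.
    apply: ler_pM; rewrite ?invr_ge0 ?powR_ge0//; first exact: HL.
    rewrite invf_le1 ?powR_gt0// -[leLHS](powRr0 (1 + mt)).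
    by rewrite ler_powR ?(ltW P0)// lerDl.
  have tk0 := t_gt0 k.
  apply: ler_pM.
  - exact: powR_ge0.
  - by apply: mulr_ge0; rewrite ?invr_ge0 ?powR_ge0.
  - rewrite ge0_ler_powR ?nnegrE ?(ltW p0) ?rearr_ge0//.
    by apply: noninc => //; case/andP: kt.
  apply: ler_pM; rewrite ?invr_ge0 ?powR_ge0//; first exact: HC5.
  rewrite ler_pdivlMr ?powR_gt0// mulrC ler_pdivrMr ?powR_gt0//.
  rewrite -powRM ?(ltW C40) ?(ltW m1)//.
  have MC : M k.+1 <= C4 * (1 + mt) by apply: HC4t => //; case/andP: kt => _ /ltW.
  by rewrite ge0_ler_powR ?nnegrE ?(ltW P0) ?(ltW (M0 _)) ?(le_trans (ltW (M0
    _)) MC).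
have step k : ((cc k.+1)%:E * lebesgue_measure (A k.+1) <= (C5 * C4 `^ P *
    (x k.+1 `^ p * (hk k `^ gam / M k.+1 `^ P)))%:E)%E.
  rewrite lebesgue_measure_scale// -EFinM lee_fin.
  set lhs := (X in X <= _); set rhs := (X in _ <= X).
  have rhs0 : 0 <= rhs.
    apply: mulr_ge0; first exact: mulr_ge0 (ltW C50) (powR_ge0 _ _).
    by rewrite mulr_ge0 ?powR_ge0// divr_ge0 ?powR_ge0.
  have -> : lhs = rhs * (1 - lam).
    rewrite /lhs /rhs /cc; have MP := powR_gt0 P (M0 k.+1); have tk := t_gt0 k.
    field.
    by rewrite (lt0r_neq0 MP) (lt0r_neq0 tk) (lt0r_neq0 (lt_trans ltr01 C1)).
  by rewrite ler_piMr// gerBl ltW.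
have step0 : ((cc 0%N)%:E * lebesgue_measure (A 0%N) <= (c0 `^ p * L * K `^
  p)%:E)%E.
  rewrite /A lebesgue_measure_itv/= lte_fin beta1 -EFinD -EFinM lee_fin.
  rewrite powRM ?(ltW K0) ?(ltW c0_gt0)// [leRHS]mulrAC.
  rewrite ler_piMr ?mulr_ge0 ?powR_ge0//.
  by rewrite gerBl ltW.
apply: nneseries_le => [k|[|N]].
- by rewrite mule_ge0// lee_fin.
- by rewrite big_ord0 lee_fin mulr_ge0 ?powR_ge0// ltW.
rewrite big_ord_recl.
apply: (@le_trans _ _ ((c0 `^ p * L * K `^ p)%:E +
    (C5 * C4 `^ P * (CH * K `^ p))%:E)%E); last first.
  rewrite -EFinD lee_fin /CC !mulrDl mul1r mulrA lerDl.
  exact: powR_ge0.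
apply: leeD => //.
apply: (@le_trans _ _ (\sum_(k < N) (C5 * C4 `^ P *
    (x k.+1 `^ p * (hk k `^ gam / M k.+1 `^ P)))%:E)%E).
  by apply: lee_sum => k _; exact: step.
rewrite sumEFin lee_fin -mulr_sumr ler_wpM2l//.
  exact: mulr_ge0 (ltW C50) (powR_ge0 _ _).
apply: (@jumps_hardy R x hk (g f) alpha c0 K x0 (controlled_jump f) hk0
  (controlled_jump_ge0 _ _ _ fK) alpha01 (ltW c0_gt0) K0 (controlled_rearr0 _ _
    _ fK)
  p CB N ap CB0) => n.
exact: sum_jump_ratio_le.
Qed.

Section weighted.
Variables (p c : R) (u : R -> R).
Hypotheses (p_gt0 : 0 < p) (p_le : p <= alpha) (u_weight : weight u)
  (c_gt0 : 0 < c) (uc : forall t : R, 0 < t < 1 ->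
     (\int[lebesgue_measure]_(z in `]0%R, t[) (u z `^ p / z)%:E
     <= (c * (psi t * t `^ (- theta)) `^ p)%:E)%E).

Let U (z : R) : \bar R := (u z `^ p / z)%:E.

Let U_ge0 (z : R) : 0 < z -> (0 <= U z)%E.
Proof. by move=> z0; rewrite lee_fin divr_ge0 ?powR_ge0// ltW. Qed.

Let measurable_U (y : R) : measurable_fun (`]0%R, y[%classic : set R) U.
Proof.
apply/measurable_EFinP; apply: (eq_measurable_fun
    (fun z : R => u z `^ p * z `^ (-1))).
  by move=> z; rewrite inE/= in_itv/= => /andP[z0 _]; rewrite powR_inv1// ltW.
apply: measurable_funM; last by apply: measurable_funTS; exact: measurable_powR.
apply: (@measurableT_comp _ _ _ _ _ _ (@powR R ^~ p)).
  exact: measurable_powR.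
have [_ [m_u _ _]] := u_weight; apply: measurable_funS m_u => //.
by move=> z /=; rewrite !in_itv/= => /andP[-> _].
Qed.

(** v is bounded on [1/2, 1), so the bounds for the integrals over (0, t) pass
to the limit t -> 1. *)
Let weighted_integral_fin : exists2 c1 : R, 0 <= c1 &
  (\int[lebesgue_measure]_(z in `]0%R, 1%R[) U z <= c1%:E)%E.
Proof.
exists (c * (psi 1 * 2^-1 `^ (- theta)) `^ p).
  by rewrite mulr_ge0 ?powR_ge0// ltW.
pose r n : R := 1 - n.+2%:R^-1.
have r1 n : 2^-1 <= r n < 1.
  have n2 : (n.+2%:R^-1 : R) <= 2^-1 by rewrite lef_pV2 ?posrE// ler_nat.
  have n0 : (0 : R) < n.+2%:R^-1 by rewrite invr_gt0.
  by move: n2 n0; rewrite /r; move: (n.+2%:R^-1) => y; lra.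
pose E n := `]0%R, r n[%classic : set R.
have EU : \bigcup_n E n = `]0%R, 1%R[%classic.
  apply/seteqP; split => z /=.
    move=> [n _]; rewrite /E /= !in_itv/= => /andP[-> zr]/=.
    by case/andP: (r1 n) => _; exact: lt_trans.
  rewrite in_itv/= => /andP[z0 /ltr_add_invr[n zn]]; exists n => //.
  rewrite /E /= in_itv/= z0/= /r ltrBrDr (le_lt_trans _ zn)// lerD2l.
  by rewrite lef_pV2 ?posrE// ler_nat.
have ndE : nondecreasing_seq E.
  move=> n n' nn'; apply/subsetPset => z; rewrite /E /= !in_itv/= => /andP[-> zr]/=.
  by rewrite (lt_le_trans zr)// lerD2l lerN2 lef_pV2 ?posrE// ler_nat !ltnS.
have mE n : measurable (E n) by exact: measurable_itv.
have mUE n : measurable_fun (E n) U by exact: measurable_U.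
have := @ge0_nondecreasing_set_cvg_integral _ (measurableTypeR R) R E U
  lebesgue_measure
  ndE mE mUE.
rewrite EU => /(_ _)/cvge_to_le; apply.
  by move=> n z; rewrite /E /= in_itv/= => /andP[z0 _]; exact: U_ge0.
apply: nearW => n; have /andP[rn1 rn2] := r1 n.
have rn0 : 0 < r n by apply: lt_le_trans rn1; rewrite invr_gt0.
apply: le_trans (uc (r n) _) _; first by rewrite rn0.
rewrite lee_fin ler_pM2l; last exact: c_gt0.
have h0 : (0 : R) < 2^-1 by rewrite invr_gt0.
have p1 := psi0 1 ltr01; have pr := psi0 _ rn0.
rewrite ge0_ler_powR ?nnegrE ?(ltW p_gt0)//.
- by rewrite mulr_ge0 ?powR_ge0// ltW.
- by rewrite mulr_ge0 ?powR_ge0// ltW.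
apply: ler_pM.
- exact: ltW.
- exact: powR_ge0.
- by apply: psi_nd => //; exact: ltW.
rewrite !powRN lef_pV2 ?posrE ?powR_gt0//.
by rewrite ge0_ler_powR ?nnegrE ?(ltW theta0) ?(ltW rn0) ?(ltW h0).
Qed.

(** F^p <= F(t_0)^p + sum_j (h_j g_j)^p 1_(0, t_j) on (0, 1). After integration
against u^p / z the hypothesis on u bounds the j-th term by
c (h_j g_j v(t_j))^p, and h_j v(t_j) is bounded. *)
Lemma weighted_bound_ge :
  exists2 C : R, 0 < C & forall f K, controlled p%:E f K ->
    ((\int[lebesgue_measure]_(t in `]0%R, 1%R[)
       ((rearrangement mu f t * (u t)%:E) `^ p * (t^-1)%:E)) `^ p^-1
     <= (C * K)%:E)%E.
Proof.
have [c1 c10 Uc1] := weighted_integral_fin.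
have p01 : 0 < p <= 1.
  by rewrite p_gt0 (le_trans p_le)//; case/andP: alpha01.
pose CB := 2 / besov_constant alpha s `^ p.
have CB0 : 0 <= CB by rewrite divr_ge0// powR_ge0.
pose kv := (beta `^ (- theta) * (2 / lam) `^ a) `^ p.
have kv0 : 0 <= kv by exact: powR_ge0.
pose CC := c0 `^ p * c1 + c * kv * CB + 1.
have CC0 : 0 < CC.
  rewrite ltr_wpDl// addr_ge0//; first exact: mulr_ge0 (powR_ge0 _ _) c10.
  by apply: mulr_ge0 => //; exact: mulr_ge0 (ltW c_gt0) _.
exists (CC `^ p^-1) => [|f K fK]; first exact: powR_gt0.
have [ff K0 fB _] := fK.
have noninc := @rearr_noninc _ _ _ _ mu_infinite alpha alpha0 f ff.
pose x k := @rearr R d T mu f (t_ k).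
have x0 k : 0 <= x k by exact: rearr_ge0.
(* the index is shifted: A 0 belongs to F(t_0), A k.+1 to the k-th jump *)
pose A k : set R := if k is k'.+1 then `]0%R, t_ k'[%classic else `]0%R,
  1%R[%classic.
pose dd k := if k is k'.+1 then (hk k' * g f k') `^ p else (c0 * K) `^ p.
have dd0 k : 0 <= dd k by case: k => [|k]; exact: powR_ge0.
have t1 k : t_ k < 1.
  apply: le_lt_trans beta1; rewrite -[leRHS]t0E.
  by apply: scale_le => //; exact: ltW.
have AD k : A k `<=` `]0%R, 1%R[%classic.
  case: k => [//|k] z /=; rewrite !in_itv/= => /andP[-> zt]/=.
  exact: lt_trans zt (t1 k).
have mA k : measurable (A k) by case: k => [|k]; exact: measurable_itv.
have patch_ge0 k z : (0 <= (U \_ (A k)) z)%E.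
  rewrite /patch; case: ifPn => // /set_mem /AD/=.
  by rewrite in_itv/= => /andP[z0 _]; exact: U_ge0.
have mUA k : measurable_fun (`]0%R, 1%R[%classic : set R) (U \_ (A k)).
  apply/measurable_restrict => //; rewrite setIidr; last exact: AD.
  by case: k => [|k]; exact: measurable_U.
set I := (\int[_]_(t in _) _)%E.
suff H : (I <= (CC * K `^ p)%:E)%E.
  have I0 : (0 <= I)%E.
    apply: integral_ge0 => t /=; rewrite in_itv/= => /andP[t0 _].
    by rewrite mule_ge0 ?poweR_ge0// lee_fin invr_ge0 ltW.
  exact: poweR_root_le (ltW CC0) (ltW K0) p_gt0 I0 H.
apply: (@le_trans _ _ (\int[lebesgue_measure]_(t in `]0%R, 1%R[)
    \sum_(k <oo) ((dd k)%:E * (U \_ (A k)) t))%E).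
  apply: ge0_le_integral_nonmeas => t /=; rewrite in_itv/= => /andP[t0 t1'].
    by rewrite mule_ge0 ?poweR_ge0// lee_fin invr_ge0 ltW.
  rewrite (rearrE mu_infinite alpha alpha0 f ff)//.
  rewrite /=.
  have u0 : 0 < u t by apply: (proj1 u_weight).
  rewrite powRM ?rearr_ge0 ?(ltW u0)// -EFinM -mulrA EFinM -/(U t).
  have [N [FN AN]] : exists N, @rearr R d T mu f t <= x N /\ forall k, (k <
    N.+1)%N -> A k t.
    have [bt|tb] := leP beta t.
      exists 0%N; split; first by rewrite /x t0E; exact: noninc.
      by case=> //= _; rewrite in_itv/= t0.
    have [|n /andP[nt tn]] := @scale_cell R beta lam beta0 lam0 lam1 t _.
      by rewrite t0.
    exists n.+1; split; first exact: noninc.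
    case=> [|k]; rewrite /= in_itv/= t0//= ltnS ltnS => kn.
    by apply: lt_le_trans tn _; exact: scale_le.
  apply: le_trans (nneseries_lim_ge N.+1 _); last first.
    by move=> k _; rewrite mule_ge0// lee_fin.
  rewrite big_mkord.
  have -> : (\sum_(k < N.+1) ((dd k)%:E * (U \_ (A k)) t) =
      (\sum_(k < N.+1) dd k)%:E * U t)%E.
    rewrite -sumEFin ge0_sume_distrl; last by move=> k _; rewrite lee_fin.
    apply: eq_bigr => k _; congr (_ * _)%E.
    by rewrite /patch mem_set//; exact: AN.
  rewrite lee_wpmul2r ?U_ge0// lee_fin.
  apply: (@le_trans _ _ (x N `^ p)).
    by rewrite ge0_ler_powR ?nnegrE ?(ltW p_gt0)// ?rearr_ge0.
  apply: le_trans (telescope_powR x hk (g f) x0 (controlled_jump f) hk0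
    (controlled_jump_ge0 _ _ _ fK) p N p01) _.
  rewrite [leRHS]big_ord_recl lerD//.
  rewrite ge0_ler_powR ?nnegrE ?(ltW p_gt0)//.
    by rewrite mulr_ge0 ?(ltW K0) ?(ltW c0_gt0).
  exact: controlled_rearr0 _ _ _ fK.
rewrite integral_nneseries//; first last.
- by move=> k z _; rewrite mule_ge0// lee_fin.
- by move=> k; apply: measurable_funeM; exact: mUA.
have IA k : (\int[lebesgue_measure]_(z in `]0%R, 1%R[) ((dd k)%:E * (U \_ (A
  k)) z) =
    (dd k)%:E * \int[lebesgue_measure]_(z in A k) U z)%E.
  rewrite ge0_integralZl ?lee_fin//; last exact: mUA.
  by rewrite -integral_mkcondr setIidr//; exact: AD.
apply: nneseries_le => [k|N].
  by apply: integral_ge0 => z _; rewrite mule_ge0// lee_fin.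
pose ee k := if k is k'.+1 then c * kv * g f k' `^ p else c0 `^ p * c1 * K `^ p.
apply: (@le_trans _ _ (\sum_(k < N) (ee k)%:E)%E).
  apply: lee_sum => -[k kN] _ /=; rewrite IA; case: k {kN} => [|k] /=.
    rewrite mulrAC EFinM lee_pmul//; first by rewrite lee_fin powR_ge0.
      by apply: integral_ge0 => z /=; rewrite in_itv/= => /andP[z0 _]; exact: U_ge0.
    by rewrite lee_fin powRM ?(ltW K0) ?(ltW c0_gt0).
  have tk1 : 0 < t_ k < 1 by rewrite t_gt0 t1.
  apply: (@le_trans _ _ (((hk k * g f k) `^ p)%:E *
      (c * (psi (t_ k) * t_ k `^ (- theta)) `^ p)%:E)%E).
    by rewrite lee_wpmul2l ?lee_fin ?powR_ge0// uc.
  have v0 : 0 <= psi (t_ k) * t_ k `^ (- theta).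
    by rewrite mulr_ge0 ?powR_ge0// ltW// psi0.
  have hkk := ltW (hk0 k); have gk := controlled_jump_ge0 _ _ _ fK k.
  rewrite -EFinM lee_fin mulrCA -mulrA ler_pM2l//.
  rewrite [in leLHS]powRM// mulrAC ler_wpM2r ?powR_ge0//.
  rewrite -powRM// /kv ge0_ler_powR ?nnegrE ?(ltW p_gt0)//.
  - exact: mulr_ge0.
  - by rewrite mulr_ge0 ?powR_ge0.
  - exact: cell_weight_dual.
rewrite sumEFin lee_fin; case: N => [|N].
  by rewrite big_ord0 mulr_ge0 ?powR_ge0// ltW.
rewrite big_ord_recl /= /CC !mulrDl mul1r.
rewrite (_ : \sum_(i < N) _ = c * kv * \sum_(i < N) g f i `^ p); last first.
  by rewrite mulr_sumr.
apply: (@le_trans _ _ (c0 `^ p * c1 * K `^ p + c * kv * CB * K `^ p)); last first.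
  by rewrite lerDl powR_ge0.
rewrite lerD2l -[leRHS]mulrA ler_wpM2l//; first exact: mulr_ge0 (ltW c_gt0) _.
exact: sum_jump_ratio_le.
Qed.

End weighted.

End embedding.

Local Open Scope ereal_scope.

Theorem theorem22 (R : realType) (d : measure_display)
    (T : metricMeasurableType R d) (mu : {measure set T -> \bar R})
    (doubling_mu : doubling_space mu)
    (mu_infinite : mu [set: T] = +oo)
    (mu_point : forall x : T, mu [set x] = 0)
    (noncollapsing_mu : noncollapsing mu)
    (X : ri_space mu)
    (concave_phi :
       @convex_function R R^o `]0%R, +oo[ (fun t => (- fundamental X t)%R))
    (alpha s : R) (q : \bar R)
    (alpha01 : (0 < alpha <= 1)%R) (s01 : (0 < s < 1)%R) (q_gt0 : 0 < q) :
  let m := embedding_fun X s alpha q in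
  let rhs f := besov_seminorm X s alpha q f + sum_norm mu alpha f in
  (m 0%R < +oo ->
     exists2 C : R, (0 < C)%R & forall f, sum_space mu alpha f ->
       'N[mu]_(+oo)[EFin \o f] <= C%:E * rhs f) /\
  (m 0%R = +oo ->
     [/\ forall p : R, q = p%:E -> (alpha < p)%R ->
           exists2 C : R, (0 < C)%R & forall f, sum_space mu alpha f ->
             (\int[lebesgue_measure]_(t in `]0%R, 1%R[)
                (rearrangement mu f t `^ p *
                 (`|derive1 (fine \o m) t|%:E / (1 + m t) `^ (p / alpha)))) `^ p^-1
             <= C%:E * rhs f,
         q = +oo ->
           exists2 C : R, (0 < C)%R & forall f, sum_space mu alpha f ->
             ereal_sup [set rearrangement mu f t / (1 + m t) `^ alpha^-1 |
                          t in `]0%R, 1%R]]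
             <= C%:E * rhs f &
         forall p : R, q = p%:E -> (p <= alpha)%R ->
           let v t := (power_fundamental X alpha t *
                       t `^ (- (s / upper_dimension mu)))%R in
           forall u : R -> R, weight u ->
             (exists2 c : R, (0 < c)%R & forall t : R, (0 < t < 1)%R ->
                \int[lebesgue_measure]_(z in `]0%R, t[) (u z `^ p / z)%:E
                <= (c * v t `^ p)%:E) ->
             exists2 C : R, (0 < C)%R & forall f, sum_space mu alpha f ->
               (\int[lebesgue_measure]_(t in `]0%R, 1%R[)
                  ((rearrangement mu f t * (u t)%:E) `^ p * (t^-1)%:E)) `^ p^-1
               <= C%:E * rhs f]).

Proof.
move=> m rhs.
have [b b01 mu_ball1] := noncollapsingP noncollapsing_mu.
have s0 : (0 < s)%R by case/andP: s01.
have bound N := @bound_by_controlled _ _ _ _ X alpha s q N q_gt0.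
split=> [m0|minf].
  apply: bound; move: m0; rewrite /m /embedding_fun.
  case: q q_gt0 {m rhs} => [p||]// p0; last first.
    exact: (Lnorm_oo_bound_y X doubling_mu mu_infinite concave_phi alpha s b).
  case: ifPn => [ap|].
    exact: (Lnorm_oo_bound_lt X doubling_mu mu_infinite concave_phi alpha s b).
  rewrite -leNgt => pa; set h := ereal_sup _ => hoo.
  have h0 : maxe 0 h \is a fin_num by rewrite ge0_fin_numE// le_max lexx.
  apply: (Lnorm_oo_bound_ge X doubling_mu mu_infinite concave_phi alpha s b alpha01 s0
    b01 mu_ball1 p (fine (maxe 0 h)) p0 pa) => z /andP[z0 z1].
  rewrite -lee_fin fineK// le_max; apply/orP; right; apply: ereal_sup_ubound.
  by exists z => //=; rewrite (ltW z0).
split=> [p qp ap|qy|p qp pa v u wu [c c0 uc]].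
- apply: bound; rewrite /m qp /embedding_fun ap.
  exact: (strong_type_bound_lt X doubling_mu mu_infinite concave_phi alpha s b).
- apply: bound; rewrite /m qy.
  exact: (weak_type_bound_y X doubling_mu mu_infinite concave_phi alpha s b).
- apply: bound; rewrite qp in q_gt0 *.
  exact: (weighted_bound_ge X doubling_mu mu_infinite concave_phi alpha s b
    alpha01 s0 b01 mu_ball1 p c u q_gt0 pa wu c0 uc).
Qed.
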